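(* Consider the compound MAC model with arbitrarily correlated sources and side information, where there is no multiple access interference: receiver $k$'s channel output is $Y_k=(Y_{1,k},Y_{2,k})$ and the memoryless channel satisfies $$p(y_{1,1},y_{2,1},y_{1,2},y_{2,2}|x_1,x_2)=p(y_{1,1},y_{1,2}|x_1)\,p(y_{2,1},y_{2,2}|x_2).$$ Source-channel rate $b$ is achievable if there exists an input distribution $p(x_1)p(x_2)$ such that for $(k,l)\in\{(1,2),(2,1)\}$: $$H(S_k|S_l,W_k)<b\,I(X_k;Y_{k,k}),\quad H(S_l|S_k,W_k)<b\,I(X_l;Y_{l,k}),\quad H(S_k,S_l|W_k)<b\,[I(X_k;Y_{k,k})+I(X_l;Y_{l,k})].$$ Conversely, if $b$ is achievable then these inequalities hold with $<$ replaced by $\le$ for some input distribution of product form.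
   Context: Compound MAC model: $\{(S_{1,k},S_{2,k},W_{1,k},W_{2,k})\}_{k\ge1}$ i.i.d. $\sim p(s_1,s_2,w_1,w_2)$ on finite alphabets. Transmitter $i\in\{1,2\}$ observes $S_i^m$ and sends $X_i^n=f_i^{(m,n)}(S_i^m)$. The channel is discrete memoryless with finite alphabets. Receiver $k\in\{1,2\}$ observes $(Y_k^n,W_k^m)$ and outputs $(\hat S_{k,1}^m,\hat S_{k,2}^m)=g_k^{(m,n)}(Y_k^n,W_k^m)$, an estimate of both sources. Error probability $P_e^{(m,n)}=\Pr\{\bigcup_{k=1,2}\{(S_1^m,S_2^m)\neq(\hat S_{k,1}^m,\hat S_{k,2}^m)\}\}$. Rate $b$ is achievable if for every $\epsilon>0$ there exist positive integers $m,n$ with $n/m=b$ and encoders/decoders with $P_e^{(m,n)}<\epsilon$.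
   Formalization: The achievability part is stated only for rates b that are ratios of positive integers, since achievability requires n/m = b exactly and so fails for every irrational b even when the strict inequalities hold. *)

(* Defs.v *)
From Stdlib Require Import Reals.
From mathcomp Require Import all_boot.
Set Implicit Arguments.
Unset Strict Implicit.
Unset Printing Implicit Defensive.
Open Scope R_scope.

Definition rsum (T : finType) (F : T -> R) : R := \big[Rplus/0]_(t : T) F t.
Definition rprod (T : finType) (F : T -> R) : R := \big[Rmult/1]_(t : T) F t.

Definition pmf (T : finType) (p : T -> R) : Prop :=
  (forall t, 0 <= p t) /\ rsum p = 1.

Definition kernel (X Y : finType) (q : X -> Y -> R) : Prop :=
  forall x, pmf (q x).

Definition prob (T : finType) (p : T -> R) (E : pred T) : R :=
  \big[Rplus/0]_(t : T | E t) p t.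

(* -x ln x with the convention 0 ln 0 = 0 *)
Definition entr (x : R) : R := if Rlt_dec 0 x then - (x * ln x) else 0.

Definition ent (T U : finType) (p : T -> R) (f : T -> U) : R :=
  rsum (fun u : U => entr (prob p (fun t => f t == u))).

Definition pairrv (T U V : finType) (f : T -> U) (g : T -> V) : T -> U * V :=
  fun t => (f t, g t).

Definition cent (T U V : finType) (p : T -> R) (f : T -> U) (g : T -> V) : R :=
  ent p (pairrv f g) - ent p g.

Definition minf (T U V : finType) (p : T -> R) (f : T -> U) (g : T -> V) : R :=
  ent p f + ent p g - ent p (pairrv f g).

Section CompoundMAC.
(* sources S1, S2 and side informations W1 (at receiver 1), W2 (at receiver 2) *)
Variables S1 S2 W1 W2 : finType.
(* channel inputs; Y_{i,k} is the output of transmitter i's sub-channel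
   observed by receiver k *)
Variables X1 X2 Y11 Y12 Y21 Y22 : finType.

Definition srcT := (S1 * S2 * W1 * W2)%type.
Definition s1_ (t : srcT) : S1 := t.1.1.1.
Definition s2_ (t : srcT) : S2 := t.1.1.2.
Definition w1_ (t : srcT) : W1 := t.1.2.
Definition w2_ (t : srcT) : W2 := t.2.

Definition jointX1 (P1 : X1 -> R) (q1 : X1 -> Y11 * Y12 -> R) :
  X1 * (Y11 * Y12) -> R := fun t => P1 t.1 * q1 t.1 t.2.
Definition jointX2 (P2 : X2 -> R) (q2 : X2 -> Y21 * Y22 -> R) :
  X2 * (Y21 * Y22) -> R := fun t => P2 t.1 * q2 t.1 t.2.

Definition I_X1Y11 P1 q1 := minf (jointX1 P1 q1) fst (fun t => t.2.1).
Definition I_X1Y12 P1 q1 := minf (jointX1 P1 q1) fst (fun t => t.2.2).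
Definition I_X2Y21 P2 q2 := minf (jointX2 P2 q2) fst (fun t => t.2.1).
Definition I_X2Y22 P2 q2 := minf (jointX2 P2 q2) fst (fun t => t.2.2).

Definition mac_conditions (rel : R -> R -> Prop) (p : srcT -> R)
    (q1 : X1 -> Y11 * Y12 -> R) (q2 : X2 -> Y21 * Y22 -> R)
    (P1 : X1 -> R) (P2 : X2 -> R) (b : R) : Prop :=
  rel (cent p s1_ (pairrv s2_ w1_)) (b * I_X1Y11 P1 q1) /\
  rel (cent p s2_ (pairrv s1_ w1_)) (b * I_X2Y21 P2 q2) /\
  rel (cent p (pairrv s1_ s2_) w1_) (b * (I_X1Y11 P1 q1 + I_X2Y21 P2 q2)) /\
  rel (cent p s2_ (pairrv s1_ w2_)) (b * I_X2Y22 P2 q2) /\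
  rel (cent p s1_ (pairrv s2_ w2_)) (b * I_X1Y12 P1 q1) /\
  rel (cent p (pairrv s1_ s2_) w2_) (b * (I_X2Y22 P2 q2 + I_X1Y12 P1 q1)).

(* Error probability of an (m,n) source-channel code:
   source blocks i.i.d. ~ p, encoders f_i : S_i^m -> X_i^n, memoryless
   channel p(y11,y12|x1) p(y21,y22|x2), decoder k observes (Y_{1,k}^n,
   Y_{2,k}^n, W_k^m) and outputs an estimate of (S_1^m, S_2^m).
   Error event: some receiver decodes wrongly. *)
Definition err_prob (m n : nat) (p : srcT -> R)
    (q1 : X1 -> Y11 * Y12 -> R) (q2 : X2 -> Y21 * Y22 -> R)
    (f1 : {ffun 'I_m -> S1} -> {ffun 'I_n -> X1})
    (f2 : {ffun 'I_m -> S2} -> {ffun 'I_n -> X2})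
    (g1 : {ffun 'I_n -> Y11} -> {ffun 'I_n -> Y21} -> {ffun 'I_m -> W1} ->
          {ffun 'I_m -> S1} * {ffun 'I_m -> S2})
    (g2 : {ffun 'I_n -> Y12} -> {ffun 'I_n -> Y22} -> {ffun 'I_m -> W2} ->
          {ffun 'I_m -> S1} * {ffun 'I_m -> S2}) : R :=
  rsum (fun sv : {ffun 'I_m -> srcT} =>
    let s1v := [ffun i => s1_ (sv i)] in
    let s2v := [ffun i => s2_ (sv i)] in
    let w1v := [ffun i => w1_ (sv i)] in
    let w2v := [ffun i => w2_ (sv i)] in
    rprod (fun i => p (sv i)) *
    rsum (fun y1 : {ffun 'I_n -> Y11 * Y12} =>
    rsum (fun y2 : {ffun 'I_n -> Y21 * Y22} =>
      rprod (fun j => q1 (f1 s1v j) (y1 j)) *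
      rprod (fun j => q2 (f2 s2v j) (y2 j)) *
      (if (g1 [ffun j => (y1 j).1] [ffun j => (y2 j).1] w1v != (s1v, s2v))
          || (g2 [ffun j => (y1 j).2] [ffun j => (y2 j).2] w2v != (s1v, s2v))
       then 1 else 0)))).

Definition achievable (p : srcT -> R)
    (q1 : X1 -> Y11 * Y12 -> R) (q2 : X2 -> Y21 * Y22 -> R) (b : R) : Prop :=
  forall eps : R, 0 < eps ->
    exists m n : nat, (0 < m)%N /\ (0 < n)%N /\ INR n / INR m = b /\
      exists f1 f2 g1 g2, err_prob (m:=m) (n:=n) p q1 q2 f1 f2 g1 g2 < eps.

End CompoundMAC.

(* Main.v *)
(* Achievability: draw both codebooks at random, letter by letter, from P1 and P2.
   A receiver accepts a pair (s1, s2) when the three ratios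
   p(s1|s2,w) a1(y1|x1)/r1(y1),  p(s2|s1,w) a2(y2|x2)/r2(y2)  and
   p(s1,s2|w) a1(y1|x1)/r1(y1) a2(y2|x2)/r2(y2)  all exceed a threshold th.
   By Markov's inequality the wrong pairs pass with probability at most 3/th. The
   true pair fails with a probability which Chernoff's bound controls by moments that
   are multiplicative over blocks; each logarithm has a positive mean by hypothesis,
   so th can grow exponentially while these probabilities still decay.

   Converse: a single application of Gibbs' inequality compares the true law with one
   built from the decoder's guess and a product output law r, and bounds the conditional
   entropy of the sources by the mean of ln (Q/r) plus a Fano term. Taking for r the
   output law of the time-averaged input turns that mean into n I(P; a), with no appeal
   to concavity. The inputs obtained for error probabilities tending to 0 have a limit
   point in the compact simplex, and mutual information is continuous there. *)
Require Import Defs.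
From Stdlib Require Import Reals Lra Lia ClassicalEpsilon.
From HB Require Import structures.
From mathcomp Require Import all_boot.
Set Implicit Arguments.
Unset Strict Implicit.
Unset Printing Implicit Defensive.
Open Scope R_scope.

(** Source words index codewords directly; no message set or bin index intervenes. The factors
    p(s1|s2,w), p(s2|s1,w) and p(s1,s2|w) in the tests are weights of total mass at most 1 over the
    candidates, so the exponentially many wrong words cost nothing, where a typicality argument
    would have to count them. Both receivers must be served by the same codebooks; hence the
    one-receiver bounds keep the average over codebooks, which are fixed only after the two mean
    errors have been added.

    In the converse the two input blocks may be dependent through the sources, whereas a product
    input law is wanted. This is harmless: without interference and with a product reference law, ln
    (Q/r) splits into one term per transmitter, and the mean of each term sees only one input
    marginal. The averaged marginals depend on the source and the encoders, not on the receiver, so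
    a single pair serves all six inequalities and no time-sharing variable appears. *)

Local Notation "\S_ ( x : T ) F" := (rsum (fun x : T => F))
  (at level 41, F at level 41, x name, format "\S_ ( x  :  T )  F").
Local Notation "\S_ ( x ) F" := (rsum (fun x => F))
  (at level 41, F at level 41, x name, format "\S_ ( x )  F").
Local Notation "\P_ ( x ) F" := (rprod (fun x => F))
  (at level 41, F at level 41, x name, format "\P_ ( x )  F").

(** * Finite sums and products *)

Lemma RplusA : associative Rplus. Proof. move=> x y z; ring. Qed.
Lemma RmultA : associative Rmult. Proof. move=> x y z; ring. Qed.
HB.instance Definition _ :=
  Monoid.isComLaw.Build R 0 Rplus RplusA Rplus_comm Rplus_0_l.
HB.instance Definition _ :=
  Monoid.isComLaw.Build R 1 Rmult RmultA Rmult_comm Rmult_1_l.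
HB.instance Definition _ :=
  Monoid.isMulLaw.Build R 0 Rmult Rmult_0_l Rmult_0_r.
HB.instance Definition _ :=
  Monoid.isAddLaw.Build R Rmult Rplus Rmult_plus_distr_r Rmult_plus_distr_l.

Definition ind (c : bool) : R := if c then 1 else 0.

Lemma ind_ge0 c : 0 <= ind c. Proof. by case: c => /=; lra. Qed.
Lemma ind_le1 c : ind c <= 1. Proof. by case: c => /=; lra. Qed.
Lemma ind_and (c d : bool) : ind (c && d) = ind c * ind d.
Proof. by case: c; case: d; rewrite /ind /=; ring. Qed.
Lemma ind_le (c d : bool) : (c -> d) -> ind c <= ind d.
Proof. by case: c; case: d => h; rewrite /ind; try lra; have := h isT. Qed.

Section Sums.
Variables (T U : finType).
Implicit Types (F G : T -> R).

Lemma rsum_eq F G : (forall t, F t = G t) -> rsum F = rsum G.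
Proof. by move=> h; apply: eq_bigr => t _. Qed.

Lemma rprod_eq F G : (forall t, F t = G t) -> rprod F = rprod G.
Proof. by move=> h; apply: eq_bigr => t _. Qed.

Lemma rsum_le F G : (forall t, F t <= G t) -> rsum F <= rsum G.
Proof.
move=> h; rewrite /rsum; elim/big_ind2: _ => [|x y z w *|t _]; [lra|lra|exact: h].
Qed.

Lemma rsum_ge0 F : (forall t, 0 <= F t) -> 0 <= rsum F.
Proof.
move=> h; rewrite /rsum; elim/big_ind: _ => [|x y *|t _]; [lra|lra|exact: h].
Qed.

Lemma rsumD F G : rsum (fun t => F t + G t) = rsum F + rsum G.
Proof. exact: big_split. Qed.

Lemma rsum_mull c F : rsum (fun t => c * F t) = c * rsum F.
Proof. by rewrite /rsum big_distrr. Qed.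

Lemma rsum_mulr c F : rsum (fun t => F t * c) = rsum F * c.
Proof. by rewrite /rsum big_distrl. Qed.

Lemma rsumN F : rsum (fun t => - F t) = - rsum F.
Proof.
rewrite -[RHS]Rmult_1_l -Ropp_mult_distr_r Ropp_mult_distr_l -rsum_mull.
by apply: rsum_eq => t; ring.
Qed.

Lemma rsumB F G : rsum (fun t => F t - G t) = rsum F - rsum G.
Proof. by rewrite /Rminus rsumD rsumN. Qed.

Lemma rsum0 F : (forall t, F t = 0) -> rsum F = 0.
Proof. by move=> h; apply: big1 => t _. Qed.

Lemma rsum_const c : rsum (fun _ : T => c) = INR #|T| * c.
Proof.
rewrite /rsum big_const; elim: #|T| => [|n IH]; first by rewrite /=; ring.
rewrite S_INR iterS IH; ring.
Qed.

Lemma rsum_exch (F : T -> U -> R) :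
  \S_(t) \S_(u) F t u = \S_(u) \S_(t) F t u.
Proof. exact: exchange_big. Qed.

Lemma rsum_pair (F : T * U -> R) : rsum F = \S_(t) \S_(u) F (t, u).
Proof.
rewrite /rsum (pair_bigA _ (fun t u => F (t, u))); apply: eq_bigr => -[] //.
Qed.

Lemma rsum_delta F a : \S_(t) ind (t == a) * F t = F a.
Proof.
rewrite /rsum (bigD1 a) //= eqxx big1 /ind; first ring.
by move=> t /negbTE ->; ring.
Qed.

Lemma rsum_ge_term F a : (forall t, 0 <= F t) -> F a <= rsum F.
Proof.
move=> h; rewrite /rsum (bigD1 a) //=.
suff: 0 <= \big[Rplus/0]_(i | i != a) F i by lra.
elim/big_ind: _ => [|x y *|t _]; [lra|lra|exact: h].
Qed.

Lemma rprod_ge0 F : (forall t, 0 <= F t) -> 0 <= rprod F.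
Proof.
move=> h; rewrite /rprod; elim/big_ind: _ => [|x y|t _]; [lra| |exact: h].
exact: Rmult_le_pos.
Qed.

Lemma rprod_gt0 F : (forall t, 0 < F t) -> 0 < rprod F.
Proof.
move=> h; rewrite /rprod; elim/big_ind: _ => [|x y|t _]; [lra| |exact: h].
exact: Rmult_lt_0_compat.
Qed.

Lemma rprodM F G : rprod (fun t => F t * G t) = rprod F * rprod G.
Proof. exact: big_split. Qed.

Lemma rprod1 F : (forall t, F t = 1) -> rprod F = 1.
Proof. by move=> h; apply: big1 => t _. Qed.

Lemma rprod_eq0 F t : F t = 0 -> rprod F = 0.
Proof. by move=> h; rewrite /rprod (bigD1 t) //= h Rmult_0_l. Qed.

Lemma rprod_const c : rprod (fun _ : T => c) = c ^ #|T|.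
Proof. by rewrite /rprod big_const; elim: #|T| => //= n ->. Qed.

Lemma rprod_delta F (a : T) :
  \P_(t) (if t == a then F t else 1) = F a.
Proof.
rewrite /rprod (bigD1 a) //= eqxx big1; first ring.
by move=> t /negbTE ->.
Qed.

Lemma rprod_gt0_inv F t : (forall t, 0 <= F t) -> 0 < rprod F -> 0 < F t.
Proof.
move=> h0 h; case: (Rle_lt_or_eq_dec _ _ (h0 t)) => // e.
by move: h; rewrite (rprod_eq0 (t := t)) //; lra.
Qed.

Lemma ln_rprod F : (forall t, 0 < F t) -> ln (rprod F) = \S_(t) ln (F t).
Proof.
move=> h; suff: 0 < rprod F /\ ln (rprod F) = \S_(t) ln (F t) by case.
rewrite /rprod /rsum; elim/big_ind2: _ => [|x1 x2 y1 y2|t _]; first by rewrite ln_1; lra.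
- by move=> [? <-] [? <-]; rewrite ln_mult //; split=> //; apply: Rmult_lt_0_compat.
- by split.
Qed.

Lemma rprod_rsum (F : T -> U -> R) :
  \P_(t) \S_(u) F t u = \S_(f : {ffun T -> U}) \P_(t) F t (f t).
Proof. exact: bigA_distr_bigA. Qed.

Lemma ind_ffun (f g : {ffun T -> U}) : ind (f == g) = \P_(t) ind (f t == g t).
Proof.
case: (f =P g) => [->|ne].
  by rewrite rprod1 // => t; rewrite eqxx.
have /existsP [t ht] : [exists t, f t != g t].
  rewrite -negb_forall; apply/negP => /forallP h; apply: ne.
  by apply/ffunP => t; apply/eqP.
by rewrite (rprod_eq0 (t := t)) // (negbTE ht).
Qed.

End Sums.

(** Change of variables along [h]: the inner sum is the push-forward of the weights [F]. Marginal
    laws enter the development through this identity. *)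
Lemma rsum_partition (T U : finType) (F : T -> R) (h : T -> U) (G : U -> R) :
  \S_(t) F t * G (h t) = \S_(u) (\S_(t) F t * ind (h t == u)) * G u.
Proof.
rewrite (rsum_eq (G := fun u => \S_(t) ind (u == h t) * (F t * G u))).
  by rewrite rsum_exch; apply: rsum_eq => t; rewrite rsum_delta.
by move=> u; rewrite -rsum_mulr; apply: rsum_eq => t; rewrite eq_sym; ring.
Qed.

Lemma probE (T : finType) (p : T -> R) (E : pred T) :
  prob p E = \S_(t) p t * ind (E t).
Proof.
rewrite /prob /rsum big_mkcond; apply: eq_bigr => t _.
by rewrite /ind; case: (E t); ring.
Qed.

(** * Entropy, mutual information and memoryless blocks *)

Section Information.
Variables (T U V : finType) (p : T -> R).
Hypothesis p0 : forall t, 0 <= p t.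

(** The law of [f] read at the outcome [t] instead of at a value. Entropies thereby become means
    over the one space [T], and identities between them reduce to pointwise identities of
    logarithms. *)
Definition fiber_mass (W : finType) (f : T -> W) (t : T) : R :=
  prob p (fun t' => f t' == f t).

Definition cond_prob (u : T -> U) (v : T -> V) (a : U) (c : V) : R :=
  prob p (fun t => pairrv u v t == (a, c)) / prob p (fun t => v t == c).

Lemma prob_ge0 (E : pred T) : 0 <= prob p E.
Proof.
by rewrite probE; apply: rsum_ge0 => t; apply: Rmult_le_pos => //; apply: ind_ge0.
Qed.

Lemma fiber_mass_ge (W : finType) (f : T -> W) t : p t <= fiber_mass f t.
Proof.
rewrite /fiber_mass probE.
have := @rsum_ge_term T (fun s => p s * ind (f s == f t)) t.
rewrite eqxx /ind Rmult_1_r; apply=> s; apply: Rmult_le_pos => //; exact: ind_ge0.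
Qed.

Lemma entr_ge0E x : 0 <= x -> entr x = - (x * ln x).
Proof.
rewrite /entr; case: Rlt_dec => //= h1 h2.
have -> : x = 0 by lra.
by rewrite Rmult_0_l Ropp_0.
Qed.

Lemma ent_fiber (W : finType) (f : T -> W) :
  ent p f = - \S_(t) p t * ln (fiber_mass f t).
Proof.
rewrite (rsum_partition p f (fun w => ln (prob p (fun t => f t == w)))) -rsumN.
apply: rsum_eq => w; rewrite entr_ge0E; last exact: prob_ge0.
by rewrite {1}probE.
Qed.

Lemma cond_probE u v t :
  cond_prob u v (u t) (v t) = fiber_mass (pairrv u v) t / fiber_mass v t.
Proof. by []. Qed.

Lemma cond_prob_gt0 u v t : 0 < p t -> 0 < cond_prob u v (u t) (v t).
Proof.
move=> h; rewrite cond_probE; apply: Rdiv_lt_0_compat.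
  exact: Rlt_le_trans h (fiber_mass_ge _ _).
exact: Rlt_le_trans h (fiber_mass_ge _ _).
Qed.

Lemma prob_pair_sum (u : T -> U) (v : T -> V) c :
  \S_(a) prob p (fun t => pairrv u v t == (a, c)) = prob p (fun t => v t == c).
Proof.
rewrite (rsum_eq (G := fun a => \S_(t) ind (a == u t) * (p t * ind (v t == c)))).
  by rewrite rsum_exch probE; apply: rsum_eq => t; rewrite rsum_delta.
move=> a; rewrite probE; apply: rsum_eq => t.
by rewrite /pairrv xpair_eqE ind_and eq_sym; ring.
Qed.

Lemma cond_prob_ge0 u v a c : 0 <= cond_prob u v a c.
Proof.
rewrite /cond_prob; case: (Rle_lt_or_eq_dec _ _ (prob_ge0 (fun t => v t == c))) => h.
  by apply: Rmult_le_pos; [exact: prob_ge0|left; apply: Rinv_0_lt_compat].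
by rewrite -h /Rdiv Rinv_0; lra.
Qed.

(** Only an inequality: where the conditioning value has mass zero, the convention [/ 0 = 0] makes
    the whole row vanish. A sub-probability is enough for the union bounds. *)
Lemma cond_prob_sum u v c : \S_(a) cond_prob u v a c <= 1.
Proof.
rewrite rsum_mulr prob_pair_sum.
case: (Rle_lt_or_eq_dec _ _ (prob_ge0 (fun t => v t == c))) => h.
  by right; field; lra.
by rewrite -h /Rdiv Rinv_0; lra.
Qed.

Lemma cent_cond_prob u v :
  cent p u v = - \S_(t) p t * ln (cond_prob u v (u t) (v t)).
Proof.
rewrite /cent !ent_fiber -!rsumN -rsumB; apply: rsum_eq => t.
rewrite cond_probE; case: (Rle_lt_or_eq_dec _ _ (p0 t)) => h; last by rewrite -h; ring.
rewrite /Rdiv ln_mult ?ln_Rinv; first ring.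
- exact: Rlt_le_trans h (fiber_mass_ge _ _).
- exact: Rlt_le_trans h (fiber_mass_ge _ _).
- by apply: Rinv_0_lt_compat; apply: Rlt_le_trans h (fiber_mass_ge _ _).
Qed.

End Information.

(** * Product laws on blocks and additivity of entropy *)

Section Blocks.
Variables (T : finType) (p : T -> R) (m : nat).

Definition blk (U : finType) (f : T -> U) (t : {ffun 'I_m -> T}) : {ffun 'I_m -> U} :=
  [ffun i => f (t i)].

Definition pblk (t : {ffun 'I_m -> T}) : R := \P_(i) p (t i).

End Blocks.
Arguments pblk {T} p {m} t.

Definition kblk (X Y : finType) (n : nat) (a : X -> Y -> R)
  (x : {ffun 'I_n -> X}) (y : {ffun 'I_n -> Y}) : R := \P_(j) a (x j) (y j).

Lemma pmf_rprod (I Y : finType) (q : I -> Y -> R) :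
  (forall i, pmf (q i)) -> pmf (fun y : {ffun I -> Y} => \P_(i) q i (y i)).
Proof.
move=> h; split=> [y|]; first by apply: rprod_ge0 => i; case: (h i).
by rewrite -(rprod_rsum q) rprod1 // => i; case: (h i).
Qed.

Lemma pmf_pblk (T : finType) (p : T -> R) m : pmf p -> pmf (pblk (m := m) p).
Proof. by move=> h; apply: (pmf_rprod (q := fun _ => p)). Qed.

Lemma kernel_kblk (X Y : finType) n (a : X -> Y -> R) :
  kernel a -> kernel (kblk (n := n) a).
Proof. by move=> h x; apply: (pmf_rprod (q := fun j => a (x j))). Qed.

(** By linearity one coordinate [i] remains at a time. Its term is a product over all coordinates in
    which only the [i]-th factor carries [h]; the other factors sum to 1. *)
Lemma mean_additive (I Y : finType) (q h : I -> Y -> R) :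
  (forall i, pmf (q i)) ->
  \S_(y : {ffun I -> Y}) (\P_(i) q i (y i)) * (\S_(i) h i (y i)) =
  \S_(i) \S_(z) q i z * h i z.
Proof.
move=> hq; under rsum_eq => y do rewrite -rsum_mull.
rewrite rsum_exch; apply: rsum_eq => i.
rewrite -(rprod_delta (fun i => \S_(z) q i z * h i z) i).
rewrite (rprod_eq (G := fun k => \S_(z) q k z * (if k == i then h k z else 1))).
  rewrite rprod_rsum; apply: rsum_eq => y; rewrite rprodM; congr (_ * _).
  by rewrite (rprod_delta (fun i => h i (y i))).
move=> k; case: (k == i) => //; under rsum_eq => z do rewrite Rmult_1_r.
by case: (hq k).
Qed.

Lemma block_marginal (I A B : finType) (q : I -> A -> R) (h : A -> B)
    (F : {ffun I -> B} -> R) :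
  \S_(z : {ffun I -> A}) (\P_(i) q i (z i)) * F [ffun i => h (z i)] =
  \S_(y : {ffun I -> B}) (\P_(i) \S_(c) q i c * ind (h c == y i)) * F y.
Proof.
rewrite (rsum_partition _ (fun z : {ffun I -> A} => [ffun i => h (z i)])).
apply: rsum_eq => y; congr (_ * _); rewrite rprod_rsum; apply: rsum_eq => z.
by rewrite rprodM ind_ffun; congr (_ * _); apply: rprod_eq => i; rewrite ffunE.
Qed.

Section BlockEntropy.
Variables (T U W : finType) (p : T -> R) (m : nat).
Variables (F : {ffun 'I_m -> T} -> W) (f : T -> U).
Hypothesis hp : pmf p.
Hypothesis Ff : forall t t', (F t' == F t) = [forall i, f (t' i) == f (t i)].

(** [F] is constrained only through its fibres. A pair of blocks has the same fibres as the block of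
    pairs, so both are covered without transporting along a bijection between their types. *)
Lemma fiber_mass_blk t : fiber_mass (pblk p) F t = \P_(i) fiber_mass p f (t i).
Proof.
rewrite /fiber_mass probE (rprod_eq (fun i => probE _ _)) rprod_rsum.
apply: rsum_eq => t'; rewrite rprodM; congr (_ * _); rewrite Ff.
rewrite (rprod_eq (G := fun i => ind ([ffun i => f (t' i)] i == [ffun i => f (t i)] i))).
  rewrite -ind_ffun; congr ind; apply/forallP/eqP => [h|/ffunP h i].
    by apply/ffunP => i; rewrite !ffunE; apply/eqP.
  by have := h i; rewrite !ffunE => /eqP.
by move=> i; rewrite !ffunE.
Qed.

Lemma ent_blk : ent (pblk (m := m) p) F = INR m * ent p f.
Proof.
have [p0 _] := hp; have [pb0 _] := pmf_pblk m hp.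
rewrite !ent_fiber // -Ropp_mult_distr_r; congr (- _).
transitivity (\S_(t : {ffun 'I_m -> T})
  pblk p t * \S_(i) ln (fiber_mass p f (t i))).
  apply: rsum_eq => t; case: (Rle_lt_or_eq_dec _ _ (pb0 t)) => h; last by rewrite -h; ring.
  rewrite fiber_mass_blk ln_rprod // => i.
  apply: Rlt_le_trans (fiber_mass_ge p0 f (t i)).
  exact: (rprod_gt0_inv i (fun i => p0 (t i)) h).
rewrite (mean_additive (q := fun _ => p) (fun _ z => ln (fiber_mass p f z))) //.
by rewrite rsum_const card_ord.
Qed.

End BlockEntropy.

Lemma blk_fiber (T U : finType) m (f : T -> U) (t t' : {ffun 'I_m -> T}) :
  (blk f t' == blk f t) = [forall i, f (t' i) == f (t i)].
Proof.
apply/eqP/forallP => [/ffunP h i|h]; first by have := h i; rewrite !ffunE => /eqP.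
by apply/ffunP => i; rewrite !ffunE; apply/eqP.
Qed.

Lemma pair_blk_fiber (T U V : finType) m
    (F : {ffun 'I_m -> T} -> U) (G : {ffun 'I_m -> T} -> V)
    (U' V' : finType) (f : T -> U') (g : T -> V') (t t' : {ffun 'I_m -> T}) :
  (F t' == F t) = [forall i, f (t' i) == f (t i)] ->
  (G t' == G t) = [forall i, g (t' i) == g (t i)] ->
  (pairrv F G t' == pairrv F G t) = [forall i, pairrv f g (t' i) == pairrv f g (t i)].
Proof.
move=> hF hG; rewrite /pairrv xpair_eqE hF hG.
apply/andP/forallP => [[/forallP h1 /forallP h2] i|h].
  by rewrite xpair_eqE h1 h2.
by split; apply/forallP => i; have := h i; rewrite xpair_eqE => /andP [].
Qed.

(** * Mutual information as a functional of the input law *)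

Section Channel.
Variables (X Y : finType).
Implicit Types (P : X -> R) (a : X -> Y -> R).

Definition out P a (y : Y) : R := \S_(x) P x * a x y.

Definition mi P a : R := \S_(x) \S_(y) P x * a x y * ln (a x y / out P a y).

Definition marg (Z : finType) (h : Z -> Y) (q : X -> Z -> R) (x : X) (y : Y) : R :=
  \S_(z) q x z * ind (h z == y).

Lemma out_pmf P a : pmf P -> kernel a -> pmf (out P a).
Proof.
move=> [P0 P1] ha; split=> [y|].
  by apply: rsum_ge0 => x; apply: Rmult_le_pos => //; case: (ha x).
rewrite /out rsum_exch -P1; apply: rsum_eq => x.
by rewrite rsum_mull; have [_ ->] := ha x; ring.
Qed.

Lemma out_ge P a x y : pmf P -> kernel a -> P x * a x y <= out P a y.
Proof.
move=> [P0 P1] ha; apply: (@rsum_ge_term _ (fun x => P x * a x y)) => x'.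
by apply: Rmult_le_pos => //; case: (ha x').
Qed.

Lemma out_gt0 P a x y : pmf P -> kernel a -> 0 < P x -> 0 < a x y -> 0 < out P a y.
Proof.
move=> hP ha h1 h2; apply: Rlt_le_trans (out_ge x y hP ha).
exact: Rmult_lt_0_compat.
Qed.

Lemma marg_kernel (Z : finType) (h : Z -> Y) (q : X -> Z -> R) :
  kernel q -> kernel (marg h q).
Proof.
move=> hq x; have [q0 q1] := hq x; split=> [y|].
  by apply: rsum_ge0 => z; apply: Rmult_le_pos => //; apply: ind_ge0.
rewrite /marg rsum_exch -q1; apply: rsum_eq => z.
under rsum_eq => y do rewrite Rmult_comm eq_sym.
by rewrite rsum_delta.
Qed.

(** The form suited to continuity in [P]: entropies of the output law, which is linear in [P], minus
    a term linear in [P]. No quotient remains. *)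
Lemma mi_entr P a : pmf P -> kernel a ->
  mi P a = \S_(y) entr (out P a y) - \S_(x) P x * \S_(y) entr (a x y).
Proof.
move=> hP ha; have [P0 P1] := hP; have [o0 o1] := out_pmf hP ha.
transitivity (\S_(x) \S_(y) (P x * a x y * - ln (out P a y) - P x * entr (a x y))).
  apply: rsum_eq => x; apply: rsum_eq => y; have [a0 _] := ha x.
  rewrite entr_ge0E //.
  case: (Rle_lt_or_eq_dec _ _ (a0 y)) => h; last by rewrite -h; ring.
  case: (Rle_lt_or_eq_dec _ _ (P0 x)) => h'; last by rewrite -h'; ring.
  have ho := out_gt0 hP ha h' h.
  by rewrite /Rdiv ln_mult ?ln_Rinv //; [ring|apply: Rinv_0_lt_compat].
under rsum_eq => x do rewrite rsumB rsum_mull.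
rewrite rsumB; congr (_ - _); rewrite rsum_exch; apply: rsum_eq => y.
by rewrite rsum_mulr entr_ge0E // /out; ring.
Qed.

(** Links the entropy form of the statement to the log-likelihood form used in both directions. The
    fibre masses of input, output and pair are [P x], the output law, and [P x] times the marginal
    channel. *)
Lemma minf_mi (Z : finType) (h : Z -> Y) (q : X -> Z -> R) P :
  pmf P -> kernel q ->
  minf (fun t : X * Z => P t.1 * q t.1 t.2) fst (fun t => h t.2) = mi P (marg h q).
Proof.
move=> hP hq; have [P0 P1] := hP; have hm := marg_kernel h hq.
set p := fun t : X * Z => P t.1 * q t.1 t.2.
have p0 t : 0 <= p t by apply: Rmult_le_pos => //; case: (hq t.1).
have f1 x z : fiber_mass p fst (x, z) = P x.
  rewrite /fiber_mass probE rsum_pair /=.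
  rewrite -[RHS](rsum_delta P); apply: rsum_eq => x' /=.
  transitivity (ind (x' == x) * P x' * \S_(z) q x' z); last by have [_ ->] := hq x'; ring.
  by rewrite -rsum_mull; apply: rsum_eq => z'; rewrite /p /=; ring.
have f3 x z : fiber_mass p (pairrv fst (fun t => h t.2)) (x, z) = P x * marg h q x (h z).
  rewrite /fiber_mass probE rsum_pair /=.
  rewrite -[RHS](rsum_delta (fun x => P x * marg h q x (h z)) x).
  apply: rsum_eq => x' /=; rewrite /marg -!rsum_mull; apply: rsum_eq => z'.
  by rewrite /pairrv xpair_eqE ind_and /p /=; ring.
have f2 x z : fiber_mass p (fun t => h t.2) (x, z) = out P (marg h q) (h z).
  rewrite /fiber_mass probE rsum_pair /=; apply: rsum_eq => x' /=.
  by rewrite /marg -!rsum_mull; apply: rsum_eq => z'; rewrite /p /=; ring.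
rewrite /minf !ent_fiber // !rsum_pair.
rewrite (_ : forall a b c : R, - a + - b - - c = c - (a + b)); last by move=> *; ring.
rewrite -rsumD -rsumB; apply: rsum_eq => x; rewrite -rsumD -rsumB.
transitivity (\S_(z) P x * q x z * ln (marg h q x (h z) / out P (marg h q) (h z))).
  apply: rsum_eq => z; rewrite f1 f2 f3 /p /=; have [q0 _] := hq x.
  case: (Rle_lt_or_eq_dec _ _ (P0 x)) => hx; last by rewrite -hx; ring.
  case: (Rle_lt_or_eq_dec _ _ (q0 z)) => hz; last by rewrite -hz; ring.
  have ma : 0 < marg h q x (h z).
    have := @rsum_ge_term Z (fun z' => q x z' * ind (h z' == h z)) z.
    rewrite eqxx /ind Rmult_1_r => e; apply: Rlt_le_trans hz _; apply: e => z'.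
    by apply: Rmult_le_pos => //; apply: ind_ge0.
  have ho := out_gt0 hP hm hx ma.
  rewrite /Rdiv !ln_mult ?ln_Rinv //; [ring|exact: Rinv_0_lt_compat].
rewrite (rsum_partition _ h (fun y => ln (marg h q x y / out P (marg h q) y))).
apply: rsum_eq => y; congr (_ * _); rewrite /marg -rsum_mull.
by apply: rsum_eq => z; ring.
Qed.

End Channel.

(** * One-shot converse *)

Lemma ln_le_sub1 x : 0 < x -> ln x <= x - 1.
Proof. by move=> h; have := exp_ineq1_le (ln x); rewrite exp_ln //; lra. Qed.

Lemma ln_le x y : 0 < x -> x <= y -> ln x <= ln y.
Proof. by move=> h [/(ln_increasing _ _ h)|->]; lra. Qed.

Lemma ln_div x y : 0 < x -> 0 < y -> ln (x / y) = ln x - ln y.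
Proof. by move=> hx hy; rewrite ln_mult ?ln_Rinv //; apply: Rinv_0_lt_compat. Qed.

Lemma ln_ratio x y z t : 0 < x -> 0 < y -> 0 < z -> 0 < t ->
  ln (x * y / (z * t)) = ln x + ln y - ln z - ln t.
Proof.
by move=> *; rewrite ln_div ?ln_mult //; [ring| |]; apply: Rmult_lt_0_compat.
Qed.

Lemma pmf_inhabited (T : finType) (p : T -> R) : pmf p -> inhabited T.
Proof.
move=> [_ h]; case: (pickP T) => [t _|e]; first exact: inhabits.
by move: h; rewrite /rsum big1 => [|t _]; [lra|have := e t].
Qed.

Lemma INR_card_ge1 (T : finType) (t : T) : 1 <= INR #|T|.
Proof.
have /leP h : (0 < #|T|)%N by apply/card_gt0P; exists t.
by have := le_INR _ _ h.
Qed.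

Lemma pmf_prod (A B : finType) (r : A -> R) (s : B -> R) :
  pmf r -> pmf s -> pmf (fun y : A * B => r y.1 * s y.2).
Proof.
move=> [r0 r1] [s0 s1]; split=> [y|]; first exact: Rmult_le_pos.
rewrite rsum_pair -r1; apply: rsum_eq => a /=; rewrite rsum_mull s1; ring.
Qed.

Section OneShotConverse.
Variables (T U V Y : finType) (p : T -> R) (u : T -> U) (v : T -> V).
Variables (Q : T -> Y -> R) (r : V -> Y -> R) (guess : V -> Y -> U) (d : R).
Hypotheses (hp : pmf p) (hQ : kernel Q) (hr : kernel r) (hd : 0 < d < 1).
Hypothesis ac : forall t y, 0 < p t -> 0 < Q t y -> 0 < r (v t) y.

(* Gibbs' inequality for the true law p Q against p(v) r(y|v) phi(u|v,y), where
   phi puts mass 1-d on the guess and spreads d uniformly: with this reference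
   measure no chain rule or data-processing inequality is needed. *)
Lemma one_shot_converse :
  cent p u v <= \S_(t) p t * (\S_(y) Q t y * ln (Q t y / r (v t) y))
    + (\S_(t) p t * (\S_(y) Q t y * ind (guess (v t) y != u t)))
      * (ln (INR #|U|) - ln d) - ln (1 - d).
Proof.
have [p0 p1] := hp.
have N1 : 1 <= INR #|U| by have [t0] := pmf_inhabited hp; exact: INR_card_ge1 (u t0).
set N := INR #|U| in N1 *.
pose phi c y a := (1 - d) * ind (a == guess c y) + d / N.
have phi0 c y a : 0 < phi c y a.
  apply: Rplus_le_lt_0_compat; last by apply: Rdiv_lt_0_compat; lra.
  by apply: Rmult_le_pos; [lra|exact: ind_ge0].
have phi1 c y : \S_(a) phi c y a = 1.
  rewrite rsumD rsum_mull rsum_const -/N.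
  have := rsum_delta (fun _ : U => 1) (guess c y).
  under rsum_eq => a do rewrite Rmult_1_r.
  by move=> ->; field; lra.
(* A correct guess costs at most -ln (1-d) and a wrong one exactly ln N - ln d; since -ln (1-d) is
   nonnegative, one formula covers both cases. *)
have lnphi c y a : - ln (phi c y a) <= ind (guess c y != a) * (ln N - ln d) - ln (1 - d).
  have dN : 0 < d / N by apply: Rdiv_lt_0_compat; lra.
  rewrite /phi eq_sym; case: (guess c y == a); rewrite /ind /=.
    have : ln (1 - d) <= ln ((1 - d) * 1 + d / N) by apply: ln_le; lra.
    lra.
  rewrite Rmult_0_r Rplus_0_l /Rdiv ln_mult ?ln_Rinv; try lra.
    have := ln_le_sub1 (x := 1 - d); lra.
  by apply: Rinv_0_lt_compat; lra.
pose k := fun a c => cond_prob p u v a c.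
have k0 a c : 0 <= / k a c.
  have := cond_prob_ge0 p0 u v a c; rewrite -/(k a c) => h.
  case: (Rle_lt_or_eq_dec _ _ h) => h'; first by left; apply: Rinv_0_lt_compat.
  by rewrite -h' Rinv_0; lra.
(* The reference law has mass at most 1: p(u,v) divided by p(u|v) is p(v), or 0 where p(u,v) = 0,
   and [phi] and [r] are normalised. *)
have mass : \S_(t) p t * (/ k (u t) (v t) * \S_(y) r (v t) y * phi (v t) y (u t)) <= 1.
  rewrite (rsum_partition p (pairrv u v)
    (fun ac => / k ac.1 ac.2 * \S_(y) r ac.2 y * phi ac.2 y ac.1)).
  apply: (Rle_trans _ (\S_(ac : U * V) prob p (fun t => v t == ac.2)
            * \S_(y) r ac.2 y * phi ac.2 y ac.1)).
    apply: rsum_le => -[a c] /=; rewrite -Rmult_assoc; apply: Rmult_le_compat_r.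
      apply: rsum_ge0 => y; have [h _] := hr c.
      by apply: Rmult_le_pos => //; left.
    rewrite -probE /k /cond_prob.
    case: (Rle_lt_or_eq_dec _ _ (prob_ge0 p0 (fun t => pairrv u v t == (a, c)))) => h.
      case: (Rle_lt_or_eq_dec _ _ (prob_ge0 p0 (fun t => v t == c))) => h'.
        have canc A B : 0 < A -> 0 < B -> A * / (A / B) <= B by move=> *; right; field; lra.
        exact: canc.
      by rewrite -h' /Rdiv Rinv_0 Rmult_0_r Rinv_0; lra.
    by rewrite -h Rmult_0_l; exact: prob_ge0.
  rewrite rsum_pair rsum_exch.
  rewrite (rsum_eq (G := fun c => prob p (fun t => v t == c))).
    have := rsum_partition p v (fun _ => 1).
    rewrite (rsum_eq (G := p)); last by move=> t; ring.
    rewrite p1 => ->; right; apply: rsum_eq => c; rewrite probE; ring.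
  move=> c /=; rewrite rsum_mull rsum_exch.
  under rsum_eq => y do rewrite rsum_mull phi1 Rmult_1_r.
  by have [_ ->] := hr c; ring.
pose E t y := p t * Q t y * (ind (guess (v t) y != u t) * (ln N - ln d) - ln (1 - d)).
(* This is ln x <= x - 1 at x = r phi / (k Q), multiplied by p Q. After summation the last bracket
   is at most 1 - 1 = 0, by [mass] and the normalisation of p Q. *)
have point t y : p t * Q t y * - ln (k (u t) (v t)) <=
    p t * (Q t y * ln (Q t y / r (v t) y)) + E t y
    + (p t * (/ k (u t) (v t)) * (r (v t) y * phi (v t) y (u t)) - p t * Q t y).
  have [Q0 _] := hQ t; have [r0 _] := hr (v t).
  have pos : 0 <= p t * (/ k (u t) (v t)) * (r (v t) y * phi (v t) y (u t)).
    apply: Rmult_le_pos; first exact: Rmult_le_pos.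
    by apply: Rmult_le_pos => //; left.
  rewrite /E.
  case: (Rle_lt_or_eq_dec _ _ (p0 t)) => hpt; last by move: pos; rewrite -hpt; lra.
  case: (Rle_lt_or_eq_dec _ _ (Q0 y)) => hQt; last by move: pos; rewrite -hQt; lra.
  have hrt := ac hpt hQt; have hk := cond_prob_gt0 p0 u v hpt; rewrite -/(k _ _) in hk.
  have f0 := phi0 (v t) y (u t).
  set K := k _ _ in hk pos *; set q := Q t y in hQt *; set ry := r _ _ in hrt pos *.
  set f := phi _ _ _ in f0 pos *.
  have := lnphi (v t) y (u t); rewrite -/f.
  set e := (_ - ln (1 - d)) => he.
  have x0 : 0 < ry * f / (K * q).
    by apply: Rdiv_lt_0_compat; apply: Rmult_lt_0_compat.
  have := ln_le_sub1 x0.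
  rewrite ln_ratio // ln_div // => hl.
  have h1 : - ln K <= ln q - ln ry + e + (ry * f * / (K * q) - 1) by lra.
  have pq : 0 <= p t * q by apply: Rmult_le_pos; lra.
  apply: Rle_trans (Rmult_le_compat_l _ _ _ pq h1) _; right.
  by field; lra.
rewrite cent_cond_prob // -rsumN.
apply: (Rle_trans _ (\S_(t) \S_(y) p t * Q t y * - ln (k (u t) (v t)))).
  right; apply: rsum_eq => t; rewrite rsum_mulr rsum_mull.
  by have [_ ->] := hQ t; rewrite /k; ring.
apply: Rle_trans (rsum_le (fun t => rsum_le (point t))) _.
have pQ1 : \S_(t) \S_(y) p t * Q t y = 1.
  by rewrite -p1; apply: rsum_eq => t; rewrite rsum_mull; have [_ ->] := hQ t; ring.
have -> : \S_(t) \S_(y) (p t * (Q t y * ln (Q t y / r (v t) y)) + E t y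
     + (p t * (/ k (u t) (v t)) * (r (v t) y * phi (v t) y (u t)) - p t * Q t y))
  = \S_(t) p t * (\S_(y) Q t y * ln (Q t y / r (v t) y)) + \S_(t) \S_(y) E t y +
    (\S_(t) p t * (/ k (u t) (v t) * \S_(y) r (v t) y * phi (v t) y (u t)) - 1).
  rewrite -pQ1 -rsumB -!rsumD; apply: rsum_eq => t.
  by rewrite -!rsum_mull -rsumB -!rsumD; apply: rsum_eq => y; ring.
have -> : \S_(t) \S_(y) E t y =
   (\S_(t) p t * \S_(y) Q t y * ind (guess (v t) y != u t))
      * (ln N - ln d) - ln (1 - d).
  transitivity ((\S_(t) \S_(y) p t * Q t y * ind (guess (v t) y != u t)) * (ln N - ln d)
      - (\S_(t) \S_(y) p t * Q t y) * ln (1 - d)).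
    rewrite -!rsum_mulr -rsumB; apply: rsum_eq => t.
    by rewrite -!rsum_mulr -rsumB; apply: rsum_eq => y; rewrite /E; ring.
  rewrite pQ1 Rmult_1_l; congr (_ * _ - _); apply: rsum_eq => t.
  by rewrite -rsum_mull; apply: rsum_eq => y; ring.
by lra.
Qed.

End OneShotConverse.

Definition perr (T S1 S2 W X1 X2 Y1 Y2 : finType) (p : T -> R)
  (s1 : T -> S1) (s2 : T -> S2) (w : T -> W)
  (Q1 : X1 -> Y1 -> R) (Q2 : X2 -> Y2 -> R) (f1 : S1 -> X1) (f2 : S2 -> X2)
  (g : Y1 -> Y2 -> W -> S1 * S2) : R :=
  \S_(t) p t * \S_(y1) \S_(y2) Q1 (f1 (s1 t)) y1 * Q2 (f2 (s2 t)) y2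
    * ind (g y1 y2 (w t) != (s1 t, s2 t)).

Definition kl (X Y : finType) (a : X -> Y -> R) (r : Y -> R) (x : X) : R :=
  \S_(y) a x y * ln (a x y / r y).

Lemma kl_prod (X1 X2 Y1 Y2 : finType) (a1 : X1 -> Y1 -> R) (a2 : X2 -> Y2 -> R)
    (r1 : Y1 -> R) (r2 : Y2 -> R) x1 x2 :
  kernel a1 -> kernel a2 ->
  (forall y, 0 < a1 x1 y -> 0 < r1 y) -> (forall y, 0 < a2 x2 y -> 0 < r2 y) ->
  \S_(y : Y1 * Y2) a1 x1 y.1 * a2 x2 y.2
     * ln (a1 x1 y.1 * a2 x2 y.2 / (r1 y.1 * r2 y.2)) = kl a1 r1 x1 + kl a2 r2 x2.
Proof.
move=> h1 h2 ac1 ac2; have [p1 e1] := h1 x1; have [p2 e2] := h2 x2.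
transitivity (\S_(y1) \S_(y2) (a1 x1 y1 * ln (a1 x1 y1 / r1 y1) * a2 x2 y2
   + a1 x1 y1 * (a2 x2 y2 * ln (a2 x2 y2 / r2 y2)))).
  rewrite rsum_pair; apply: rsum_eq => y1; apply: rsum_eq => y2 /=.
  case: (Rle_lt_or_eq_dec _ _ (p1 y1)) => g1; last by rewrite -g1; ring.
  case: (Rle_lt_or_eq_dec _ _ (p2 y2)) => g2; last by rewrite -g2; ring.
  have q1 := ac1 _ g1; have q2 := ac2 _ g2.
  rewrite ln_ratio // !ln_div //; ring.
under rsum_eq => y1 do rewrite rsumD rsum_mull rsum_mull e2 -/(kl a2 r2 x2) Rmult_1_r.
by rewrite rsumD rsum_mulr e1 -/(kl a1 r1 x1); ring.
Qed.

Section ReceiverConverse.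
Variables (T S1 S2 W X1 X2 Y1 Y2 : finType) (p : T -> R).
Variables (s1 : T -> S1) (s2 : T -> S2) (w : T -> W).
Variables (Q1 : X1 -> Y1 -> R) (Q2 : X2 -> Y2 -> R) (f1 : S1 -> X1) (f2 : S2 -> X2).
Variables (g : Y1 -> Y2 -> W -> S1 * S2) (r1 : Y1 -> R) (r2 : Y2 -> R) (d : R).
Hypotheses (hp : pmf p) (hQ1 : kernel Q1) (hQ2 : kernel Q2).
Hypotheses (hr1 : pmf r1) (hr2 : pmf r2) (hd : 0 < d < 1).
Hypothesis ac1 : forall t y, 0 < p t -> 0 < Q1 (f1 (s1 t)) y -> 0 < r1 y.
Hypothesis ac2 : forall t y, 0 < p t -> 0 < Q2 (f2 (s2 t)) y -> 0 < r2 y.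

Let Pe := perr p s1 s2 w Q1 Q2 f1 f2 g.

Lemma fano_coef (U : finType) (a : U) : 0 <= ln (INR #|U|) - ln d.
Proof.
have h1 : ln 1 <= ln (INR #|U|) by apply: ln_le; [lra|exact: INR_card_ge1 a].
have := ln_le_sub1 (x := d); rewrite ln_1 in h1; lra.
Qed.

Lemma perr_ge (U : finType) (gu : T -> Y1 * Y2 -> U) (u : T -> U) :
  (forall t y, gu t y != u t -> g y.1 y.2 (w t) != (s1 t, s2 t)) ->
  \S_(t) p t * (\S_(y : Y1 * Y2) Q1 (f1 (s1 t)) y.1 * Q2 (f2 (s2 t)) y.2
      * ind (gu t y != u t)) <= Pe.
Proof.
move=> h; apply: rsum_le => t; apply: Rmult_le_compat_l; first by case: hp.
rewrite rsum_pair; apply: rsum_le => y1; apply: rsum_le => y2.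
apply: Rmult_le_compat_l; last exact: ind_le (h t (y1, y2)).
by apply: Rmult_le_pos; [case: (hQ1 (f1 (s1 t)))|case: (hQ2 (f2 (s2 t)))].
Qed.

(** Because [s2] belongs to the conditioning, the reference law may keep the true second
    sub-channel. Its likelihood ratio is 1, so only the first sub-channel is charged. *)
Lemma receiver_converse1 :
  cent p s1 (pairrv s2 w) <= \S_(t) p t * kl Q1 r1 (f1 (s1 t))
    + Pe * (ln (INR #|S1|) - ln d) - ln (1 - d).
Proof.
have [t0] := pmf_inhabited hp.
have [p0 _] := hp.
have := @one_shot_converse T S1 (S2 * W)%type (Y1 * Y2)%type p s1 (pairrv s2 w)
  (fun t y => Q1 (f1 (s1 t)) y.1 * Q2 (f2 (s2 t)) y.2)
  (fun c y => r1 y.1 * Q2 (f2 c.1) y.2)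
  (fun c y => (g y.1 y.2 c.2).1) d hp.
move/(_ (fun t => pmf_prod (hQ1 _) (hQ2 _))).
move/(_ (fun c => pmf_prod hr1 (hQ2 _)) hd).
have ac t (y : Y1 * Y2) : 0 < p t -> 0 < Q1 (f1 (s1 t)) y.1 * Q2 (f2 (s2 t)) y.2 ->
    0 < r1 y.1 * Q2 (f2 (s2 t)) y.2.
  move=> h h'; have [a0 _] := hQ1 (f1 (s1 t)); have [b0 _] := hQ2 (f2 (s2 t)).
  case: (Rle_lt_or_eq_dec _ _ (a0 y.1)) => e1; last by move: h'; rewrite -e1; lra.
  case: (Rle_lt_or_eq_dec _ _ (b0 y.2)) => e2; last by move: h'; rewrite -e2; lra.
  by apply: Rmult_lt_0_compat => //; apply: ac1 h e1.
move/(_ ac) => /= H; apply: Rle_trans H _.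
apply: Rplus_le_compat_r; apply: Rplus_le_compat; last first.
  apply: Rmult_le_compat_r; first exact: fano_coef (s1 t0).
  apply: (perr_ge (gu := fun t y => (g y.1 y.2 (w t)).1) (u := s1)) => t y.
  by apply: contra => /eqP ->.
right; apply: rsum_eq => t.
case: (Rle_lt_or_eq_dec _ _ (p0 t)) => h; last by rewrite -h; ring.
congr (_ * _).
have := kl_prod (x1 := f1 (s1 t)) (x2 := f2 (s2 t)) (r1 := r1) (r2 := Q2 (f2 (s2 t))) hQ1 hQ2.
move=> -> //; last by move=> y; exact: ac1.
rewrite [X in _ + X](_ : _ = 0); first ring.
apply: rsum0 => y; have [b0 _] := hQ2 (f2 (s2 t)).
case: (Rle_lt_or_eq_dec _ _ (b0 y)) => e; last by rewrite -e; ring.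
by rewrite (_ : _ / _ = 1) ?ln_1; [ring|field; lra].
Qed.

(** The divergence splits for each fixed source outcome, before averaging; dependence between the
    two channel inputs therefore leaves no cross term. *)
Lemma receiver_converse12 :
  cent p (pairrv s1 s2) w <=
    \S_(t) p t * kl Q1 r1 (f1 (s1 t)) + \S_(t) p t * kl Q2 r2 (f2 (s2 t))
    + Pe * (ln (INR #|S1|) + ln (INR #|S2|) - ln d) - ln (1 - d).
Proof.
have [t0] := pmf_inhabited hp.
have [p0 _] := hp.
have := @one_shot_converse T (S1 * S2)%type W (Y1 * Y2)%type p (pairrv s1 s2) w
  (fun t y => Q1 (f1 (s1 t)) y.1 * Q2 (f2 (s2 t)) y.2)
  (fun c y => r1 y.1 * r2 y.2)
  (fun c y => g y.1 y.2 c) d hp.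
move/(_ (fun t => pmf_prod (hQ1 _) (hQ2 _))).
move/(_ (fun c => pmf_prod hr1 hr2) hd).
have ac t (y : Y1 * Y2) : 0 < p t -> 0 < Q1 (f1 (s1 t)) y.1 * Q2 (f2 (s2 t)) y.2 ->
    0 < r1 y.1 * r2 y.2.
  move=> h h'; have [a0 _] := hQ1 (f1 (s1 t)); have [b0 _] := hQ2 (f2 (s2 t)).
  case: (Rle_lt_or_eq_dec _ _ (a0 y.1)) => e1; last by move: h'; rewrite -e1; lra.
  case: (Rle_lt_or_eq_dec _ _ (b0 y.2)) => e2; last by move: h'; rewrite -e2; lra.
  by apply: Rmult_lt_0_compat => //; [apply: ac1 h e1|apply: ac2 h e2].
move/(_ ac) => /= H; apply: Rle_trans H _.
apply: Rplus_le_compat_r; apply: Rplus_le_compat; last first.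
  rewrite (_ : ln (INR #|S1|) + _ = ln (INR #|{: S1 * S2}|)); last first.
    rewrite card_prod mult_INR ln_mult //.
      by have := INR_card_ge1 (s1 t0); lra.
    by have := INR_card_ge1 (s2 t0); lra.
  apply: Rmult_le_compat_r; first exact: fano_coef (s1 t0, s2 t0).
  exact: (perr_ge (gu := fun t y => g y.1 y.2 (w t)) (u := pairrv s1 s2)).
right; rewrite -rsumD; apply: rsum_eq => t.
case: (Rle_lt_or_eq_dec _ _ (p0 t)) => h; last by rewrite -h; ring.
rewrite -Rmult_plus_distr_l; congr (_ * _).
apply: kl_prod => // y; [exact: ac1|exact: ac2].
Qed.

End ReceiverConverse.

(** Exchanging the transmitters turns the bound on the first source into the bound on the second. *)
Lemma perr_swap (T S1 S2 W X1 X2 Y1 Y2 : finType) (p : T -> R)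
    (s1 : T -> S1) (s2 : T -> S2) (w : T -> W)
    (Q1 : X1 -> Y1 -> R) (Q2 : X2 -> Y2 -> R) (f1 : S1 -> X1) (f2 : S2 -> X2)
    (g : Y1 -> Y2 -> W -> S1 * S2) :
  perr p s2 s1 w Q2 Q1 f2 f1 (fun y2 y1 c => let s := g y1 y2 c in (s.2, s.1)) =
  perr p s1 s2 w Q1 Q2 f1 f2 g.
Proof.
apply: rsum_eq => t; congr (_ * _); rewrite rsum_exch.
apply: rsum_eq => y1; apply: rsum_eq => y2.
case: (g y1 y2 (w t)) => a b /=.
by rewrite !xpair_eqE andbC; ring.
Qed.

(** * Converse for block codes *)

Lemma mi_kl (X Y : finType) (P : X -> R) (a : X -> Y -> R) :
  mi P a = \S_(x) P x * kl a (out P a) x.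
Proof.
apply: rsum_eq => x; rewrite /kl -rsum_mull; apply: rsum_eq => y; ring.
Qed.

Section AverageInput.
Variables (W X Y : finType) (n : nat) (mu : W -> R) (F : W -> {ffun 'I_n -> X}).
Variable a : X -> Y -> R.
Hypotheses (hmu : pmf mu) (ha : kernel a) (hn : (0 < n)%N).

(** The law of the letter at a uniformly chosen position of the transmitted block. *)
Definition avg_in (x : X) : R :=
  / INR n * \S_(j) \S_(t) mu t * ind (F t j == x).

Lemma INR_gt0 k : (0 < k)%N -> 0 < INR k.
Proof. by move/leP => h; apply: lt_0_INR. Qed.

Lemma avg_in_pmf : pmf avg_in.
Proof.
have n0 := INR_gt0 hn; have [m0 m1] := hmu; split=> [x|].
  apply: Rmult_le_pos; first by left; apply: Rinv_0_lt_compat.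
  apply: rsum_ge0 => j; apply: rsum_ge0 => t.
  by apply: Rmult_le_pos => //; apply: ind_ge0.
rewrite rsum_mull rsum_exch (rsum_eq (G := fun _ => 1)).
  by rewrite rsum_const card_ord; field; lra.
move=> j; rewrite -m1 rsum_exch; apply: rsum_eq => t; rewrite rsum_mull.
have := rsum_delta (fun _ : X => 1) (F t j).
by under rsum_eq => x do rewrite Rmult_1_r eq_sym; move=> ->; ring.
Qed.

Lemma avg_in_gt0 t j : 0 < mu t -> 0 < avg_in (F t j).
Proof.
move=> ht; have [m0 _] := hmu; apply: Rmult_lt_0_compat.
  exact: Rinv_0_lt_compat (INR_gt0 hn).
pose H j t' := mu t' * ind (F t' j == F t j).
have H0 j' t' : 0 <= mu t' * ind (F t' j' == F t j).
  by apply: Rmult_le_pos => //; apply: ind_ge0.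
have := rsum_ge_term t (H0 j); rewrite eqxx /ind Rmult_1_r => h.
by have := rsum_ge_term j (fun j' => rsum_ge0 (H0 j')); rewrite /ind; lra.
Qed.

(** Supplies the absolute continuity that the one-shot bounds require: each letter used with
    positive probability has positive weight in the average. *)
Lemma avg_in_ac t y : 0 < mu t -> 0 < kblk a (F t) y ->
  0 < \P_(j) out avg_in a (y j).
Proof.
move=> ht h; apply: rprod_gt0 => j; apply: out_gt0 avg_in_pmf ha _ _.
  exact: avg_in_gt0 j ht.
by apply: (rprod_gt0_inv j _ h) => i; case: (ha (F t i)).
Qed.

(** With the same output law at every position, the log ratio is additive along the block and its
    mean is linear in the letter laws. Averaging over positions is then exact, hence an equality. *)
Lemma kl_avg_in :
  \S_(t) mu t * kl (kblk a) (fun y : {ffun 'I_n -> Y} => \P_(j) out avg_in a (y j)) (F t)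
  = INR n * mi avg_in a.
Proof.
have [m0 _] := hmu.
transitivity (\S_(t) mu t * \S_(j) kl a (out avg_in a) (F t j)).
  apply: rsum_eq => t.
  case: (Rle_lt_or_eq_dec _ _ (m0 t)) => ht; last by rewrite -ht; ring.
  congr (_ * _).
  rewrite -(mean_additive (fun j z => ln (a (F t j) z / out avg_in a z)) (fun j => ha (F t j))).
  apply: rsum_eq => y; rewrite -/(kblk a (F t) y); have [k0 _] := kernel_kblk ha (F t).
  case: (Rle_lt_or_eq_dec _ _ (k0 y)) => h; last by rewrite -h; ring.
  congr (_ * _).
  have a0 j : 0 < a (F t j) (y j).
    by apply: (rprod_gt0_inv j _ h) => i; case: (ha (F t i)).
  have o0 j : 0 < out avg_in a (y j).
    by apply: out_gt0 avg_in_pmf ha _ (a0 j); exact: avg_in_gt0.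
  rewrite ln_div //; last exact: avg_in_ac ht h.
  by rewrite !ln_rprod // -rsumB; apply: rsum_eq => j; rewrite ln_div.
under rsum_eq => t do rewrite -rsum_mull.
rewrite rsum_exch mi_kl.
have n0 := INR_gt0 hn.
rewrite -rsum_mull (rsum_eq (G := fun j =>
   \S_(x) (\S_(t) mu t * ind (F t j == x)) * kl a (out avg_in a) x)); last first.
  by move=> j; rewrite (rsum_partition mu (fun t => F t j)).
rewrite rsum_exch; apply: rsum_eq => x; rewrite rsum_mulr /avg_in.
by field; lra.
Qed.

End AverageInput.

Section BlockConditionalEntropy.
Variables (T U V W : finType) (p : T -> R) (m : nat).
Variables (u : T -> U) (v : T -> V) (w : T -> W).
Hypothesis hp : pmf p.

Lemma cent_blk_pairr :
  cent (pblk (m := m) p) (blk u) (pairrv (blk v) (blk w)) =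
  INR m * cent p u (pairrv v w).
Proof.
rewrite /cent Rmult_minus_distr_l; congr (_ - _); apply: ent_blk => // t t'.
  apply: pair_blk_fiber; first exact: blk_fiber.
  by apply: pair_blk_fiber; exact: blk_fiber.
by apply: pair_blk_fiber; exact: blk_fiber.
Qed.

Lemma cent_blk_pairl :
  cent (pblk (m := m) p) (pairrv (blk u) (blk v)) (blk w) =
  INR m * cent p (pairrv u v) w.
Proof.
rewrite /cent Rmult_minus_distr_l; congr (_ - _); apply: ent_blk => // t t'.
  apply: pair_blk_fiber; last exact: blk_fiber.
  by apply: pair_blk_fiber; exact: blk_fiber.
exact: blk_fiber.
Qed.

End BlockConditionalEntropy.

(** With e < d^2 the term -e ln d is at most d, since -ln d <= 1/d; -ln (1-d) is at most 2d for d <=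
    1/2; together they give the 3. [M] stands for the source block length: dividing by it leaves an
    error independent of the length. *)
Lemma fano_small d e L M : 0 < d <= 1 / 2 -> 0 <= e < d * d -> 0 <= L -> 1 <= M ->
  e * (M * L - ln d) - ln (1 - d) <= M * (d * (L + 3)).
Proof.
move=> hd he hL hM.
have l1 : - ln d <= / d - 1.
  rewrite -ln_Rinv; last lra.
  by apply: ln_le_sub1; apply: Rinv_0_lt_compat; lra.
have l2 : - ln (1 - d) <= 2 * d.
  rewrite -ln_Rinv; last lra.
  have h := @ln_le_sub1 (/ (1 - d)).
  apply: Rle_trans (h _) _; first by apply: Rinv_0_lt_compat; lra.
  have : / (1 - d) * (1 - d) = 1 by field; lra.
  have : 0 < / (1 - d) by apply: Rinv_0_lt_compat; lra.
  nra.
have l3 : e * - ln d <= d.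
  have d0 : 0 <= - ln d by have := @ln_le_sub1 d; lra.
  apply: (Rle_trans _ (d * d * / d)); last by right; field; lra.
  by apply: Rmult_le_compat; lra.
have ML : 0 <= M * L by nra.
have l4 : e * (M * L) <= d * (M * L) by apply: Rmult_le_compat_r => //; nra.
nra.
Qed.

Lemma ln_card_ffun (S : finType) m (s : S) :
  ln (INR #|{ffun 'I_m -> S}|) = INR m * ln (INR #|S|).
Proof.
rewrite card_ffun card_ord.
have -> k l : INR (k ^ l)%N = INR k ^ l.
  by elim: l => [|l IH] //; rewrite expnS mult_INR IH.
by rewrite ln_pow //; have := INR_card_ge1 s; lra.
Qed.

Lemma ln_card_ge0 (S : finType) (s : S) : 0 <= ln (INR #|S|).
Proof. by rewrite -ln_1; apply: ln_le; [lra|exact: INR_card_ge1 s]. Qed.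

Section BlockConverse.
Variables (T S1 S2 W X1 X2 Y1 Y2 : finType) (p : T -> R) (m n : nat).
Variables (s1 : T -> S1) (s2 : T -> S2) (w : T -> W).
Variables (a1 : X1 -> Y1 -> R) (a2 : X2 -> Y2 -> R).
Variables (f1 : {ffun 'I_m -> S1} -> {ffun 'I_n -> X1}).
Variables (f2 : {ffun 'I_m -> S2} -> {ffun 'I_n -> X2}).
Variables (g : {ffun 'I_n -> Y1} -> {ffun 'I_n -> Y2} -> {ffun 'I_m -> W} ->
  {ffun 'I_m -> S1} * {ffun 'I_m -> S2}).
Variable d : R.
Hypotheses (hp : pmf p) (ha1 : kernel a1) (ha2 : kernel a2).
Hypotheses (hm : (0 < m)%N) (hn : (0 < n)%N) (hd : 0 < d <= 1 / 2).
Hypothesis small : perr (pblk p) (blk s1) (blk s2) (blk w) (kblk a1) (kblk a2) f1 f2 g < d * d.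

Let P1 := avg_in (pblk p) (fun t => f1 (blk s1 t)).
Let P2 := avg_in (pblk p) (fun t => f2 (blk s2 t)).

Lemma block_converse :
  cent p s1 (pairrv s2 w) <= INR n / INR m * mi P1 a1 + d * (ln (INR #|S1|) + 3) /\
  cent p (pairrv s1 s2) w <= INR n / INR m * (mi P1 a1 + mi P2 a2)
    + d * (ln (INR #|S1|) + ln (INR #|S2|) + 3).
Proof.
have hpb := pmf_pblk m hp; have [t0] := pmf_inhabited hp; have m0 := INR_gt0 hm.
have M1 : 1 <= INR m by have /leP h := hm; have := le_INR _ _ h.
have hr1 : pmf (fun y : {ffun 'I_n -> Y1} => \P_(j) out P1 a1 (y j)).
  by apply: (pmf_rprod (q := fun _ => out P1 a1)) => _; apply: out_pmf => //; exact: avg_in_pmf.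
have hr2 : pmf (fun y : {ffun 'I_n -> Y2} => \P_(j) out P2 a2 (y j)).
  by apply: (pmf_rprod (q := fun _ => out P2 a2)) => _; apply: out_pmf => //; exact: avg_in_pmf.
have e0 : 0 <= perr (pblk p) (blk s1) (blk s2) (blk w) (kblk a1) (kblk a2) f1 f2 g.
  apply: rsum_ge0 => t; apply: Rmult_le_pos; first by case: hpb.
  apply: rsum_ge0 => y1; apply: rsum_ge0 => y2; apply: Rmult_le_pos; last exact: ind_ge0.
  apply: Rmult_le_pos; first by case: (kernel_kblk ha1 (f1 (blk s1 t))).
  by case: (kernel_kblk ha2 (f2 (blk s2 t))).
have hd' : 0 < d < 1 by lra.
have ac1 t y := avg_in_ac (F := fun t => f1 (blk s1 t)) (t := t) (y := y) hpb ha1 hn.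
have ac2 t y := avg_in_ac (F := fun t => f2 (blk s2 t)) (t := t) (y := y) hpb ha2 hn.
have L1 := ln_card_ge0 (s1 t0); have L2 := ln_card_ge0 (s2 t0).
have div x y z : INR m * x <= INR n * y + INR m * z -> x <= INR n / INR m * y + z.
  move=> h; apply: (Rmult_le_reg_l (INR m)) => //; apply: Rle_trans h _.
  by right; field; lra.
split; apply: div.
  rewrite -cent_blk_pairr //.
  apply: Rle_trans (receiver_converse1 _ _ f2 g hpb (kernel_kblk ha1) (kernel_kblk ha2) hr1 hd' ac1) _.
  rewrite kl_avg_in // ln_card_ffun; last exact: s1 t0.
  have := fano_small hd (conj e0 small) L1 M1.
  by rewrite -/P1; lra.
rewrite -cent_blk_pairl //.
apply: Rle_trans (receiver_converse12 _ g hpb (kernel_kblk ha1) (kernel_kblk ha2) hr1 hr2 hd' ac1 ac2) _.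
rewrite !kl_avg_in // !ln_card_ffun; [|exact: s2 t0|exact: s1 t0].
have := fano_small hd (conj e0 small) (Rplus_le_le_0_compat _ _ L1 L2) M1.
by rewrite -/P1 -/P2; lra.
Qed.

End BlockConverse.

(** * Compactness of the input distributions *)

Lemma cv_ext (u v : nat -> R) l : (forall k, u k = v k) -> Un_cv u l -> Un_cv v l.
Proof. by move=> E h e he; have [N hN] := h e he; exists N => k hk; rewrite -E; exact: hN. Qed.

Lemma cv_const c : Un_cv (fun _ => c) c.
Proof.
by move=> e he; exists 0%N => k _; rewrite /Rdist Rminus_diag Rabs_R0.
Qed.

Lemma cv_extract (u : nat -> R) l (phi : nat -> nat) :
  (forall k, (k <= phi k)%coq_nat) -> Un_cv u l -> Un_cv (fun k => u (phi k)) l.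
Proof.
move=> hphi h e he; have [N hN] := h e he; exists N => k hk; apply: hN.
by have := hphi k; lia.
Qed.

Lemma cv_le_bound (u : nat -> R) l x : (forall k, x <= u k) -> Un_cv u l -> x <= l.
Proof. move=> h hu; exact: Rle_cv_lim h (cv_const x) hu. Qed.

Lemma cv_rsum (T : finType) (F : nat -> T -> R) (l : T -> R) :
  (forall t, Un_cv (fun k => F k t) (l t)) -> Un_cv (fun k => rsum (F k)) (rsum l).
Proof.
move=> h; rewrite /rsum; elim: (index_enum T) => [|t s IH].
  by rewrite big_nil; apply: (cv_ext (u := fun _ => 0)) (cv_const 0) => k; rewrite big_nil.
rewrite big_cons; apply: (cv_ext (u := fun k => F k t + \big[Rplus/0]_(i <- s) F k i)).
  by move=> k; rewrite big_cons.
exact: CV_plus.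
Qed.

(** Writing x = y^2 gives -x ln x = 2 y (-y ln y), and -y ln y <= 1. It yields continuity of [entr]
    at 0, where differentiability fails. *)
Lemma entr_small x : 0 <= x <= 1 -> Rabs (entr x) <= 2 * sqrt x.
Proof.
move=> hx; rewrite entr_ge0E; last lra.
case: (Rle_lt_or_eq_dec _ _ (proj1 hx)) => x0; last first.
  by rewrite -x0 Rmult_0_l Ropp_0 Rabs_R0 sqrt_0; lra.
have y0 := sqrt_lt_R0 _ x0; have yy := sqrt_sqrt x (proj1 hx).
set y := sqrt x in y0 yy *; rewrite -yy ln_mult //.
have l0 : ln y <= 0.
  rewrite -ln_1; apply: ln_le => //; rewrite -sqrt_1; apply: sqrt_le_1_alt; lra.
have l1 : - ln y <= / y - 1.
  by rewrite -ln_Rinv //; apply: ln_le_sub1; apply: Rinv_0_lt_compat.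
have yi : y * / y = 1 by field; lra.
have l2 : y * - ln y <= 1 by nra.
rewrite Rabs_right; nra.
Qed.

Lemma cv_entr (u : nat -> R) l : (forall k, 0 <= u k) -> Un_cv u l ->
  Un_cv (fun k => entr (u k)) (entr l).
Proof.
move=> u0 hu; have l0 : 0 <= l by apply: cv_le_bound hu.
case: (Rle_lt_or_eq_dec _ _ l0) => hl.
  apply: (cv_ext (u := fun k => - (u k * ln (u k)))) => [k|]; first by rewrite entr_ge0E.
  rewrite entr_ge0E //; apply: (CV_opp (fun k => u k * ln (u k))); apply: CV_mult => //.
  apply: continuity_seq hu; apply: derivable_continuous_pt.
  by exists (/ l); apply: derivable_pt_lim_ln.
rewrite -hl in hu *; rewrite entr_ge0E; last lra.
rewrite Rmult_0_l Ropp_0 => e he.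
(* Below e^2/16 the bound 2 sqrt x is at most e/2; the minimum with 1 keeps [entr_small]
   applicable. *)
have e2 : 0 < e * e / 16 by nra.
have [N hN] := hu (Rmin 1 (e * e / 16)) (Rmin_glb_lt _ _ _ Rlt_0_1 e2).
exists N => k hk; have := hN k hk; rewrite /Rdist !Rminus_0_r.
rewrite Rabs_right; last by have := u0 k; lra.
move=> h; have h1 := Rlt_le_trans _ _ _ h (Rmin_l _ _).
have h2 := Rlt_le_trans _ _ _ h (Rmin_r _ _).
have := entr_small (conj (u0 k) (Rlt_le _ _ h1)).
have : sqrt (u k) <= e / 4.
  rewrite -(sqrt_square (e / 4)); last lra.
  by apply: sqrt_le_1_alt; lra.
lra.
Qed.

Section MutualInfoLimit.
Variables (X Y : finType) (a : X -> Y -> R) (P : nat -> X -> R) (L : X -> R).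
Hypotheses (ha : kernel a) (hP : forall k, pmf (P k)).
Hypothesis cv : forall x, Un_cv (fun k => P k x) (L x).

Lemma pmf_limit : pmf L.
Proof.
split=> [x|]; first by apply: cv_le_bound (cv x) => k; case: (hP k).
apply: UL_sequence (cv_rsum cv) _.
by apply: cv_ext (cv_const 1) => k; case: (hP k).
Qed.

Lemma cv_mi : Un_cv (fun k => mi (P k) a) (mi L a).
Proof.
rewrite mi_entr //; last exact: pmf_limit.
apply: (cv_ext (u := fun k => \S_(y) entr (out (P k) a y) - \S_(x) P k x * \S_(y) entr (a x y))).
  by move=> k; rewrite mi_entr.
apply: CV_minus.
  apply: cv_rsum => y; apply: cv_entr; first by move=> k; case: (out_pmf (hP k) ha).
  by apply: cv_rsum => x; apply: CV_mult => //; exact: cv_const.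
by apply: cv_rsum => x; apply: CV_mult => //; exact: cv_const.
Qed.

End MutualInfoLimit.

(** Strict monotonicity of [phi] is replaced by [k <= phi k], which already preserves limits and is
    stable under composition. The indices are chosen around a cluster value in [0,1]. *)
Lemma bounded_subsequence (u : nat -> R) : (forall k, 0 <= u k <= 1) ->
  exists phi : nat -> nat, (forall k, (k <= phi k)%coq_nat) /\
    exists l, Un_cv (fun k => u (phi k)) l.
Proof.
move=> hu; have [l hl] := Bolzano_Weierstrass u _ (compact_P3 0 1) hu.
have pos k : 0 < / INR (k + 2).
  by apply: Rinv_0_lt_compat; apply: INR_gt0; rewrite addn2.
have near k : exists q, (k <= q)%coq_nat /\ Rabs (u q - l) < / INR (k + 2).
  by apply: (hl (disc l (mkposreal _ (pos k))) k); exists (mkposreal _ (pos k)).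
exists (fun k => proj1_sig (constructive_indefinite_description _ (near k))).
split=> [k|]; first by case: constructive_indefinite_description => q [].
exists l => e he; have [N [hN N0]] := archimed_cor1 e he; exists N => k hk.
case: constructive_indefinite_description => q [_ /= h]; apply: Rlt_trans h _.
apply: Rlt_trans hN; apply: Rinv_lt_contravar.
  by apply: Rmult_lt_0_compat; apply: lt_0_INR; [|rewrite -plusE]; lia.
by apply: lt_INR; rewrite -plusE; lia.
Qed.

(** Coordinates are treated one after another; each further extraction keeps the limits already
    obtained. *)
Lemma bounded_subsequence_fin (T : finType) (u : nat -> T -> R) :
  (forall k t, 0 <= u k t <= 1) ->
  exists phi : nat -> nat, (forall k, (k <= phi k)%coq_nat) /\
    exists L : T -> R, forall t, Un_cv (fun k => u (phi k) t) (L t).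
Proof.
move=> hu.
suff [phi [h1 h2]] : exists phi : nat -> nat, (forall k, (k <= phi k)%coq_nat) /\
    forall t, t \in enum T -> exists l, Un_cv (fun k => u (phi k) t) l.
  exists phi; split=> //.
  have h3 t : exists l, Un_cv (fun k => u (phi k) t) l by apply: h2; rewrite mem_enum.
  exists (fun t => proj1_sig (constructive_indefinite_description _ (h3 t))) => t.
  by case: constructive_indefinite_description.
elim: (enum T) => [|t s [phi [h1 h2]]]; first by exists id.
have [psi [g1 [l g2]]] := bounded_subsequence (fun k => hu (phi k) t).
exists (fun k => phi (psi k)); split=> [k|t'].
  by have := h1 (psi k); have := g1 k; lia.
rewrite inE => /orP [/eqP ->|/h2 [l' h]]; first by exists l.
by exists l'; apply: (cv_extract (u := fun k => u (phi k) t')).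
Qed.

(** * The converse for two receivers *)

Section MarginalChannels.
Variables (X1 X2 Z1 Z2 Y1 Y2 : finType) (n : nat).
Variables (q1 : X1 -> Z1 -> R) (q2 : X2 -> Z2 -> R) (h1 : Z1 -> Y1) (h2 : Z2 -> Y2).

(** A receiver's error depends only on its own output components, so the rest of the channel can be
    summed out and only the marginal sub-channels remain. *)
Lemma block_marginal2 (x1 : {ffun 'I_n -> X1}) (x2 : {ffun 'I_n -> X2})
    (G : {ffun 'I_n -> Y1} -> {ffun 'I_n -> Y2} -> R) :
  \S_(y1 : {ffun 'I_n -> Z1}) \S_(y2 : {ffun 'I_n -> Z2})
    (\P_(j) q1 (x1 j) (y1 j)) * (\P_(j) q2 (x2 j) (y2 j)) *
    G [ffun j => h1 (y1 j)] [ffun j => h2 (y2 j)] =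
  \S_(y1) \S_(y2) kblk (marg h1 q1) x1 y1 * kblk (marg h2 q2) x2 y2 * G y1 y2.
Proof.
transitivity (\S_(y1 : {ffun 'I_n -> Z1}) (\P_(j) q1 (x1 j) (y1 j)) *
   \S_(y2) kblk (marg h2 q2) x2 y2 * G [ffun j => h1 (y1 j)] y2).
  apply: rsum_eq => y1.
  rewrite -(block_marginal (fun j => q2 (x2 j)) h2) -rsum_mull.
  by apply: rsum_eq => y2; rewrite -Rmult_assoc.
rewrite (block_marginal (fun j => q1 (x1 j)) h1
  (fun y1 => \S_(y2) kblk (marg h2 q2) x2 y2 * G y1 y2)).
apply: rsum_eq => y1; rewrite -rsum_mull; apply: rsum_eq => y2.
by rewrite -Rmult_assoc.
Qed.

End MarginalChannels.

Section TwoReceivers.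
Variables (S1 S2 W1 W2 X1 X2 Y11 Y12 Y21 Y22 : finType).
Variables (p : srcT S1 S2 W1 W2 -> R) (hp : pmf p).
Variables (q1 : X1 -> Y11 * Y12 -> R) (hq1 : kernel q1).
Variables (q2 : X2 -> Y21 * Y22 -> R) (hq2 : kernel q2).

Notation s1 := (@s1_ S1 S2 W1 W2). Notation s2 := (@s2_ S1 S2 W1 W2).
Notation w1 := (@w1_ S1 S2 W1 W2). Notation w2 := (@w2_ S1 S2 W1 W2).
Notation a11 := (marg fst q1). Notation a12 := (marg snd q1).
Notation a21 := (marg fst q2). Notation a22 := (marg snd q2).

Section Codes.
Variables (m n : nat).
Variables (f1 : {ffun 'I_m -> S1} -> {ffun 'I_n -> X1}).
Variables (f2 : {ffun 'I_m -> S2} -> {ffun 'I_n -> X2}).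
Variables (g1 : {ffun 'I_n -> Y11} -> {ffun 'I_n -> Y21} -> {ffun 'I_m -> W1} ->
  {ffun 'I_m -> S1} * {ffun 'I_m -> S2}).
Variables (g2 : {ffun 'I_n -> Y12} -> {ffun 'I_n -> Y22} -> {ffun 'I_m -> W2} ->
  {ffun 'I_m -> S1} * {ffun 'I_m -> S2}).

Let e1 := perr (pblk p) (blk s1) (blk s2) (blk w1) (kblk a11) (kblk a21) f1 f2 g1.
Let e2 := perr (pblk p) (blk s1) (blk s2) (blk w2) (kblk a12) (kblk a22) f1 f2 g2.
(** Leaving the function [J] of the two failure flags free reduces monotonicity and the union bound
    to inequalities on booleans. *)
Let joint (J : bool -> bool -> R) :=
  \S_(t : {ffun 'I_m -> srcT S1 S2 W1 W2}) pblk p t *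
  \S_(y1 : {ffun 'I_n -> Y11 * Y12}) \S_(y2 : {ffun 'I_n -> Y21 * Y22})
    (\P_(j) q1 (f1 (blk s1 t) j) (y1 j)) * (\P_(j) q2 (f2 (blk s2 t) j) (y2 j)) *
    J (g1 [ffun j => (y1 j).1] [ffun j => (y2 j).1] (blk w1 t) != (blk s1 t, blk s2 t))
      (g2 [ffun j => (y1 j).2] [ffun j => (y2 j).2] (blk w2 t) != (blk s1 t, blk s2 t)).

Lemma joint_le (J J' : bool -> bool -> R) :
  (forall c d, J c d <= J' c d) -> joint J <= joint J'.
Proof.
move=> h; apply: rsum_le => t; apply: Rmult_le_compat_l.
  by case: (pmf_pblk m hp).
apply: rsum_le => y1; apply: rsum_le => y2; apply: Rmult_le_compat_l => //.
apply: Rmult_le_pos; apply: rprod_ge0 => j; first by case: (hq1 (f1 (blk s1 t) j)).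
by case: (hq2 (f2 (blk s2 t) j)).
Qed.

Lemma joint1 : joint (fun c _ => ind c) = e1.
Proof.
apply: rsum_eq => t; congr (_ * _).
exact: (block_marginal2 q1 q2 fst fst (f1 (blk s1 t)) (f2 (blk s2 t))
  (fun y1 y2 => ind (g1 y1 y2 (blk w1 t) != (blk s1 t, blk s2 t)))).
Qed.

Lemma joint2 : joint (fun _ d => ind d) = e2.
Proof.
apply: rsum_eq => t; congr (_ * _).
exact: (block_marginal2 q1 q2 snd snd (f1 (blk s1 t)) (f2 (blk s2 t))
  (fun y1 y2 => ind (g2 y1 y2 (blk w2 t) != (blk s1 t, blk s2 t)))).
Qed.

Lemma jointD J J' : joint (fun c d => J c d + J' c d) = joint J + joint J'.
Proof.
rewrite -rsumD; apply: rsum_eq => t; rewrite -Rmult_plus_distr_l; congr (_ * _).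
rewrite -rsumD; apply: rsum_eq => y1; rewrite -rsumD; apply: rsum_eq => y2; ring.
Qed.

Lemma err_prob_joint : err_prob p q1 q2 f1 f2 g1 g2 = joint (fun c d => ind (c || d)).
Proof. by []. Qed.

Lemma perr1_le_err_prob : e1 <= err_prob p q1 q2 f1 f2 g1 g2.
Proof.
by rewrite -joint1 err_prob_joint; apply: joint_le => -[] []; rewrite /ind /=; lra.
Qed.

Lemma perr2_le_err_prob : e2 <= err_prob p q1 q2 f1 f2 g1 g2.
Proof.
by rewrite -joint2 err_prob_joint; apply: joint_le => -[] []; rewrite /ind /=; lra.
Qed.

Lemma err_prob_le_perr : err_prob p q1 q2 f1 f2 g1 g2 <= e1 + e2.
Proof.
rewrite -joint1 -joint2 -jointD err_prob_joint.
by apply: joint_le => -[] []; rewrite /ind /=; lra.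
Qed.

End Codes.
End TwoReceivers.

Section TwoReceiverConverse.
Variables (S1 S2 W1 W2 X1 X2 Y11 Y12 Y21 Y22 : finType).
Variables (p : srcT S1 S2 W1 W2 -> R) (hp : pmf p).
Variables (q1 : X1 -> Y11 * Y12 -> R) (hq1 : kernel q1).
Variables (q2 : X2 -> Y21 * Y22 -> R) (hq2 : kernel q2).

(** Groups the six conditions by receiver. A general [rel] serves the strict and the weak conditions
    as well as the weak ones with slack used before the limit. *)
Lemma mac_conditionsE (rel : R -> R -> Prop) P1 P2 b : pmf P1 -> pmf P2 ->
  mac_conditions rel p q1 q2 P1 P2 b <->
  (rel (cent p (@s1_ _ _ _ _) (pairrv (@s2_ _ _ _ _) (@w1_ _ _ _ _))) (b * mi P1 (marg fst q1)) /\
   rel (cent p (@s2_ _ _ _ _) (pairrv (@s1_ _ _ _ _) (@w1_ _ _ _ _))) (b * mi P2 (marg fst q2)) /\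
   rel (cent p (pairrv (@s1_ _ _ _ _) (@s2_ _ _ _ _)) (@w1_ _ _ _ _))
     (b * (mi P1 (marg fst q1) + mi P2 (marg fst q2)))) /\
  (rel (cent p (@s1_ _ _ _ _) (pairrv (@s2_ _ _ _ _) (@w2_ _ _ _ _))) (b * mi P1 (marg snd q1)) /\
   rel (cent p (@s2_ _ _ _ _) (pairrv (@s1_ _ _ _ _) (@w2_ _ _ _ _))) (b * mi P2 (marg snd q2)) /\
   rel (cent p (pairrv (@s1_ _ _ _ _) (@s2_ _ _ _ _)) (@w2_ _ _ _ _))
     (b * (mi P1 (marg snd q1) + mi P2 (marg snd q2)))).
Proof.
move=> hP1 hP2; rewrite /mac_conditions.
have -> : I_X1Y11 P1 q1 = mi P1 (marg fst q1) := minf_mi fst hP1 hq1.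
have -> : I_X1Y12 P1 q1 = mi P1 (marg snd q1) := minf_mi snd hP1 hq1.
have -> : I_X2Y21 P2 q2 = mi P2 (marg fst q2) := minf_mi fst hP2 hq2.
have -> : I_X2Y22 P2 q2 = mi P2 (marg snd q2) := minf_mi snd hP2 hq2.
rewrite [mi P2 (marg snd q2) + _]Rplus_comm; tauto.
Qed.

Lemma achievable_converse b : achievable p q1 q2 b ->
  exists (P1 : X1 -> R) (P2 : X2 -> R),
    pmf P1 /\ pmf P2 /\ mac_conditions Rle p q1 q2 P1 P2 b.
Proof.
move=> ach; have [t0] := pmf_inhabited hp.
have L1 := ln_card_ge0 (s1_ t0); have L2 := ln_card_ge0 (s2_ t0).
set C := ln (INR #|S1|) + ln (INR #|S2|) + 3.
(* Both input laws live in one function on the sum type, so that a single extraction makes them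
   converge along the same indices. *)
have approx k : exists P : X1 + X2 -> R,
    pmf (fun x => P (inl x)) /\ pmf (fun x => P (inr x)) /\
    mac_conditions (fun x y => x <= y + / INR (k + 2) * C) p q1 q2
      (fun x => P (inl x)) (fun x => P (inr x)) b.
  (* The shift by 2 ensures d <= 1/2; a code of error below d^2 is then requested, as [fano_small]
     needs. *)
  set d := / INR (k + 2).
  have hk2 : 2 <= INR (k + 2) by rewrite plus_INR /=; have := pos_INR k; lra.
  have hd : 0 < d <= 1 / 2.
    split; first by apply: Rinv_0_lt_compat; lra.
    by rewrite /d /Rdiv Rmult_1_l; apply: Rinv_le_contravar; lra.
  have dd : 0 < d * d by nra.
  have [m [n [hm [hn [hb [f1 [f2 [g1 [g2 herr]]]]]]]]] := ach (d * d) dd.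
  have hpb := pmf_pblk m hp.
  set P1 := avg_in (pblk p) (fun t => f1 (blk (@s1_ _ _ _ _) t)).
  set P2 := avg_in (pblk p) (fun t => f2 (blk (@s2_ _ _ _ _) t)).
  exists (fun x => match x with inl x => P1 x | inr x => P2 x end).
  have hP1 : pmf P1 by exact: avg_in_pmf.
  have hP2 : pmf P2 by exact: avg_in_pmf.
  split=> //; split=> //; apply/mac_conditionsE => //.
  (* [P1] and [P2] come from the encoders alone, so one argument with a free decoder and free
     marginal channels covers both receivers. [C] dominates the three Fano constants. *)
  have rx (W Y1 Y2 : finType) (w : srcT S1 S2 W1 W2 -> W) a1 a2
      (g : {ffun 'I_n -> Y1} -> {ffun 'I_n -> Y2} -> {ffun 'I_m -> W} -> _) :
      kernel a1 -> kernel a2 ->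
      perr (pblk p) (blk (@s1_ _ _ _ _)) (blk (@s2_ _ _ _ _)) (blk w)
        (kblk a1) (kblk a2) f1 f2 g < d * d ->
      cent p (@s1_ _ _ _ _) (pairrv (@s2_ _ _ _ _) w) <= b * mi P1 a1 + d * C /\
      cent p (@s2_ _ _ _ _) (pairrv (@s1_ _ _ _ _) w) <= b * mi P2 a2 + d * C /\
      cent p (pairrv (@s1_ _ _ _ _) (@s2_ _ _ _ _)) w
        <= b * (mi P1 a1 + mi P2 a2) + d * C.
    move=> ha1 ha2 small.
    have [c1 c12] := block_converse hp ha1 ha2 hm hn hd small.
    rewrite -perr_swap in small.
    have [c2 _] := block_converse hp ha2 ha1 hm hn hd small.
    rewrite hb in c1 c12 c2.
    by rewrite /C; split; [|split]; rewrite /P1 /P2; nra.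
  split; [apply: (rx _ _ _ _ _ _ g1)|apply: (rx _ _ _ _ _ _ g2)];
    try exact: marg_kernel.
    exact: Rle_lt_trans (perr1_le_err_prob hp hq1 hq2 f1 f2 g1 g2) herr.
  exact: Rle_lt_trans (perr2_le_err_prob hp hq1 hq2 f1 f2 g1 g2) herr.
pose P k := proj1_sig (constructive_indefinite_description _ (approx k)).
have hPk k : pmf (fun x => P k (inl x)) /\ pmf (fun x => P k (inr x)) /\
    mac_conditions (fun x y => x <= y + / INR (k + 2) * C) p q1 q2
      (fun x => P k (inl x)) (fun x => P k (inr x)) b.
  by rewrite /P; case: constructive_indefinite_description.
have bounded k x : 0 <= P k x <= 1.
  have pmf01 (X : finType) (r : X -> R) y : pmf r -> 0 <= r y <= 1.
    by move=> [r0 r1]; split=> //; rewrite -r1; exact: rsum_ge_term.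
  have [h1 [h2 _]] := hPk k.
  by case: x => x; [exact: (pmf01 _ _ x h1)|exact: (pmf01 _ _ x h2)].
have [phi [hphi [L hL]]] := bounded_subsequence_fin bounded.
have pL1 : pmf (fun x => L (inl x)).
  apply: (pmf_limit (P := fun k x => P (phi k) (inl x))) => [k|x]; last exact: hL.
  by case: (hPk (phi k)).
have pL2 : pmf (fun x => L (inr x)).
  apply: (pmf_limit (P := fun k x => P (phi k) (inr x))) => [k|x]; last exact: hL.
  by case: (hPk (phi k)) => _ [].
exists (fun x => L (inl x)), (fun x => L (inr x)); split=> //; split=> //.
have m1 (Y : finType) (a : X1 -> Y -> R) : kernel a ->
    Un_cv (fun k => mi (fun x => P (phi k) (inl x)) a) (mi (fun x => L (inl x)) a).
  move=> ha; apply: (cv_mi (P := fun k x => P (phi k) (inl x))) => // k.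
  by case: (hPk (phi k)).
have m2 (Y : finType) (a : X2 -> Y -> R) : kernel a ->
    Un_cv (fun k => mi (fun x => P (phi k) (inr x)) a) (mi (fun x => L (inr x)) a).
  move=> ha; apply: (cv_mi (P := fun k x => P (phi k) (inr x))) => // k.
  by case: (hPk (phi k)) => _ [].
have dcv : Un_cv (fun k => / INR (phi k + 2) * C) 0.
  rewrite -(Rmult_0_l C); apply: CV_mult; last exact: cv_const.
  move=> e he; have [N [hN N0]] := archimed_cor1 e he; exists N => k hk.
  have hlt : INR N < INR (phi k + 2).
    by apply: lt_INR; rewrite -plusE; have := hphi k; lia.
  have Npos := lt_0_INR _ N0.
  rewrite /Rdist Rminus_0_r Rabs_right; last first.
    by left; apply: Rinv_0_lt_compat; lra.
  by apply: Rlt_trans hN; apply: Rinv_lt_contravar => //; nra.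
have lim (v : nat -> R) l c :
    (forall k, c <= b * v k + / INR (phi k + 2) * C) -> Un_cv v l -> c <= b * l.
  move=> hc hv; apply: cv_le_bound hc _; rewrite -[b * l]Rplus_0_r.
  by apply: CV_plus dcv; apply: CV_mult => //; exact: cv_const.
have cond k := proj1 (mac_conditionsE _ _ (proj1 (hPk (phi k))) (proj1 (proj2 (hPk (phi k)))))
                 (proj2 (proj2 (hPk (phi k)))).
have k11 := marg_kernel fst hq1; have k12 := marg_kernel snd hq1.
have k21 := marg_kernel fst hq2; have k22 := marg_kernel snd hq2.
apply/mac_conditionsE => //; split; split; [|split| |split].
- apply: lim (m1 _ _ k11) => k; apply: (proj1 (proj1 (cond k))).
- apply: lim (m2 _ _ k21) => k; apply: (proj1 (proj2 (proj1 (cond k)))).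
- by apply: lim (CV_plus _ _ _ _ (m1 _ _ k11) (m2 _ _ k21)) => k; case: (cond k) => [[_ []]].
- apply: lim (m1 _ _ k12) => k; apply: (proj1 (proj2 (cond k))).
- apply: lim (m2 _ _ k22) => k; apply: (proj1 (proj2 (proj2 (cond k)))).
- by apply: lim (CV_plus _ _ _ _ (m1 _ _ k12) (m2 _ _ k22)) => k; case: (cond k) => [_ [_ []]].
Qed.

End TwoReceiverConverse.

(** * One-shot achievability *)

Section RandomCodebook.
Variables (S X Y : finType) (P : X -> R) (a : X -> Y -> R).
Hypotheses (hP : pmf P) (ha : kernel a).

Definition codebook_law (F : {ffun S -> X}) : R := \P_(s) P (F s).

Lemma codebook_pmf : pmf codebook_law.
Proof. exact: (pmf_rprod (q := fun _ => P)). Qed.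

Lemma codebook_one s (G : X -> R) :
  \S_(F) codebook_law F * G (F s) = \S_(x) P x * G x.
Proof.
transitivity (\P_(s') \S_(x) P x * (if s' == s then G x else 1)).
  rewrite rprod_rsum; apply: rsum_eq => F; rewrite rprodM; congr (_ * _).
  by rewrite (rprod_delta (fun s' => G (F s'))).
rewrite -[RHS](rprod_delta (fun _ => \S_(x) P x * G x) s).
apply: rprod_eq => s'; case: (s' == s) => //=.
by under rsum_eq => x do rewrite Rmult_1_r; case: hP.
Qed.

(** Codewords of distinct source words are independent. *)
Lemma codebook_two s s' (G H : X -> R) : s' != s ->
  \S_(F) codebook_law F * (G (F s) * H (F s')) =
  (\S_(x) P x * G x) * (\S_(x) P x * H x).
Proof.
move=> ne.
transitivity (\P_(k) \S_(x) P x * ((if k == s then G x else 1) * (if k == s' then H x else 1))).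
  rewrite rprod_rsum; apply: rsum_eq => F; rewrite !rprodM; congr (_ * (_ * _)).
    by rewrite (rprod_delta (fun k => G (F k))).
  by rewrite (rprod_delta (fun k => H (F k))).
rewrite -[X in X * _](rprod_delta (fun _ => \S_(x) P x * G x) s).
rewrite -[X in _ * X](rprod_delta (fun _ => \S_(x) P x * H x) s') -rprodM.
apply: rprod_eq => k; have [->|nk] := eqVneq k s.
  rewrite eq_sym (negbTE ne) Rmult_1_r; apply: rsum_eq => x; ring.
case: (k == s').
  by rewrite Rmult_1_l; apply: rsum_eq => x; ring.
have [_ P1] := hP; rewrite (rsum_eq (G := P)) ?P1; first ring.
by move=> x; ring.
Qed.

Lemma transmitted_mean s (h : X -> Y -> R) :
  \S_(F) codebook_law F * (\S_(y) a (F s) y * h (F s) y) =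
  \S_(x) P x * (\S_(y) a x y * h x y).
Proof. exact: (codebook_one s (fun x => \S_(y) a x y * h x y)). Qed.

Lemma transmitted_mass s :
  \S_(F : {ffun S -> X}) codebook_law F * (\S_(y) a (F s) y * 1) = 1.
Proof.
rewrite (transmitted_mean s (fun _ _ => 1)); transitivity (rsum P); last by case: hP.
apply: rsum_eq => x; under rsum_eq => y do rewrite Rmult_1_r.
by have [_ ->] := ha x; ring.
Qed.

(** Change of measure: averaged over the sent codeword, the output has law [out P a] and is
    independent of the other codeword, whose likelihood ratio then has mean 1. Outputs of mass zero
    contribute 0, hence the inequality. *)
Lemma impostor_mean s s' : s' != s ->
  \S_(F : {ffun S -> X}) codebook_law F
    * (\S_(y) a (F s) y * (a (F s') y / out P a y)) <= 1.
Proof.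
move=> ne; have [o0 o1] := out_pmf hP ha.
under rsum_eq => F do rewrite -rsum_mull.
rewrite rsum_exch -o1; apply: rsum_le => y.
rewrite (codebook_two (fun x => a x y) (fun x => a x y / out P a y) ne).
rewrite -/(out P a y).
rewrite (rsum_eq (G := fun x => P x * a x y * / out P a y)); last by move=> x; rewrite /Rdiv; ring.
rewrite rsum_mulr -/(out P a y).
case: (Rle_lt_or_eq_dec _ _ (o0 y)) => h; last by rewrite -h; lra.
by right; field; lra.
Qed.

End RandomCodebook.

(** The power x^(-s). The means [cmom] and [imom] equal 1 at s = 0, and their logarithms have slopes
    there equal to the conditional entropy and minus the mutual information. *)
Definition npow (s x : R) : R := exp (- s * ln x).

Definition cmom (T U V : finType) (p : T -> R) (u : T -> U) (v : T -> V) (s : R) : R :=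
  \S_(t) p t * npow s (cond_prob p u v (u t) (v t)).

Definition imom (X Y : finType) (P : X -> R) (a : X -> Y -> R) (s : R) : R :=
  \S_(x) P x * (\S_(y) a x y * npow s (a x y / out P a y)).

Definition ltb (x y : R) : bool := if Rlt_dec x y then true else false.

Lemma ltbP x y : reflect (x < y) (ltb x y).
Proof. by rewrite /ltb; case: Rlt_dec => h; constructor. Qed.

(** Chernoff's device: when x <= th, the power (th/x)^s is at least 1. *)
Lemma tail_npow th s x : 0 < th -> 0 <= s -> 0 < x ->
  ind (~~ ltb th x) <= exp (s * ln th) * npow s x.
Proof.
move=> t0 s0 x0; rewrite /npow -exp_plus; case: ltbP => h /=.
  by left; exact: exp_pos.
rewrite /ind -exp_0; have : ln x <= ln th by apply: ln_le; lra.
move=> hl; have : 0 <= s * ln th + - s * ln x by nra.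
by move=> [/exp_increasing|<-]; lra.
Qed.

Lemma npowM s x y : 0 < x -> 0 < y -> npow s (x * y) = npow s x * npow s y.
Proof. by move=> hx hy; rewrite /npow ln_mult // -exp_plus; congr exp; ring. Qed.

Section OneShotAchievability.
Variables (T S1 S2 W X1 X2 Y1 Y2 : finType) (p : T -> R).
Variables (s1 : T -> S1) (s2 : T -> S2) (w : T -> W).
Variables (P1 : X1 -> R) (P2 : X2 -> R) (Q1 : X1 -> Y1 -> R) (Q2 : X2 -> Y2 -> R).
Variable th : R.
Hypotheses (hp : pmf p) (hP1 : pmf P1) (hP2 : pmf P2).
Hypotheses (hQ1 : kernel Q1) (hQ2 : kernel Q2) (th0 : 0 < th).

Let K1 a b c := cond_prob p s1 (pairrv s2 w) a (b, c).
Let K2 a b c := cond_prob p s2 (pairrv s1 w) b (a, c).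
Let K12 a b c := cond_prob p (pairrv s1 s2) w (a, b) c.
Let L1 x y := Q1 x y / out P1 Q1 y.
Let L2 x y := Q2 x y / out P2 Q2 y.

Definition passes a b c x1 x2 y1 y2 : bool :=
  [&& ltb th (K1 a b c * L1 x1 y1), ltb th (K2 a b c * L2 x2 y2)
    & ltb th (K12 a b c * (L1 x1 y1 * L2 x2 y2))].

(* Uniqueness of the accepted pair is not tested: an error means anyway that the true
   pair was rejected or that another pair was accepted. *)
Definition threshold_decoder (dflt : S1 * S2) (F1 : {ffun S1 -> X1}) (F2 : {ffun S2 -> X2})
    y1 y2 c : S1 * S2 :=
  odflt dflt [pick s : S1 * S2 | passes s.1 s.2 c (F1 s.1) (F2 s.2) y1 y2].

Lemma ratio_ge0 (X Y : finType) (P : X -> R) (a : X -> Y -> R) x y :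
  pmf P -> kernel a -> 0 <= a x y / out P a y.
Proof.
move=> hP ha; have [o0 _] := out_pmf hP ha; have [a0 _] := ha x.
case: (Rle_lt_or_eq_dec _ _ (o0 y)) => h; last by rewrite -h /Rdiv Rinv_0; lra.
by apply: Rmult_le_pos => //; left; apply: Rinv_0_lt_compat.
Qed.

Let L10 x y : 0 <= L1 x y. Proof. exact: ratio_ge0. Qed.
Let L20 x y : 0 <= L2 x y. Proof. exact: ratio_ge0. Qed.
Let K10 a b c : 0 <= K1 a b c. Proof. by apply: cond_prob_ge0; case: hp. Qed.
Let K20 a b c : 0 <= K2 a b c. Proof. by apply: cond_prob_ge0; case: hp. Qed.
Let K120 a b c : 0 <= K12 a b c. Proof. by apply: cond_prob_ge0; case: hp. Qed.

Section FixedSource.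
Variables (a : S1) (b : S2) (c : W).

Let avg (H : {ffun S1 -> X1} -> {ffun S2 -> X2} -> Y1 -> Y2 -> R) : R :=
  \S_(F1) codebook_law P1 F1 * (\S_(F2) codebook_law P2 F2 *
    (\S_(y1) \S_(y2) Q1 (F1 a) y1 * Q2 (F2 b) y2 * H F1 F2 y1 y2)).

(** The comparison is required only where all weights are positive; there the likelihood ratios are
    positive, as [tail_npow] and [npowM] demand. *)
Let avg_le (H H' : {ffun S1 -> X1} -> {ffun S2 -> X2} -> Y1 -> Y2 -> R) :
  (forall (F1 : {ffun S1 -> X1}) (F2 : {ffun S2 -> X2}) y1 y2, 0 < P1 (F1 a) -> 0 < P2 (F2 b) ->
   0 < Q1 (F1 a) y1 -> 0 < Q2 (F2 b) y2 -> H F1 F2 y1 y2 <= H' F1 F2 y1 y2) ->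
  avg H <= avg H'.
Proof.
move=> h; apply: rsum_le => F1; have [c0 _] := codebook_pmf S1 hP1.
case: (Rle_lt_or_eq_dec _ _ (c0 F1)) => f1; last by rewrite -f1; lra.
apply: Rmult_le_compat_l => //; apply: rsum_le => F2; have [d0 _] := codebook_pmf S2 hP2.
case: (Rle_lt_or_eq_dec _ _ (d0 F2)) => f2; last by rewrite -f2; lra.
apply: Rmult_le_compat_l => //; apply: rsum_le => y1; apply: rsum_le => y2.
have [q0 _] := hQ1 (F1 a); have [r0 _] := hQ2 (F2 b).
case: (Rle_lt_or_eq_dec _ _ (q0 y1)) => e1; last by rewrite -e1; lra.
case: (Rle_lt_or_eq_dec _ _ (r0 y2)) => e2; last by rewrite -e2; lra.
apply: Rmult_le_compat_l; first by apply: Rmult_le_pos.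
apply: h => //.
  by apply: (rprod_gt0_inv a _ f1) => s; case: hP1.
by apply: (rprod_gt0_inv b _ f2) => s; case: hP2.
Qed.

Let avgD H H' : avg (fun F1 F2 y1 y2 => H F1 F2 y1 y2 + H' F1 F2 y1 y2) = avg H + avg H'.
Proof.
rewrite -rsumD; apply: rsum_eq => F1; rewrite -Rmult_plus_distr_l -rsumD; congr (_ * _).
apply: rsum_eq => F2; rewrite -Rmult_plus_distr_l -rsumD; congr (_ * _).
by apply: rsum_eq => y1; rewrite -rsumD; apply: rsum_eq => y2; ring.
Qed.

Let avgZ k H : avg (fun F1 F2 y1 y2 => k * H F1 F2 y1 y2) = k * avg H.
Proof.
rewrite -rsum_mull; apply: rsum_eq => F1.
rewrite -!rsum_mull; apply: rsum_eq => F2; rewrite -!rsum_mull; apply: rsum_eq => y1.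
by rewrite -!rsum_mull; apply: rsum_eq => y2; ring.
Qed.

Let avg_sum (I : finType) (H : I -> _) :
  avg (fun F1 F2 y1 y2 => \S_(i) H i F1 F2 y1 y2) = \S_(i) avg (H i).
Proof.
rewrite /avg [RHS]rsum_exch; apply: rsum_eq => F1.
rewrite [RHS]rsum_mull; congr (_ * _); rewrite [RHS]rsum_exch; apply: rsum_eq => F2.
rewrite [RHS]rsum_mull; congr (_ * _); rewrite [RHS]rsum_exch; apply: rsum_eq => y1.
by rewrite [RHS]rsum_exch; apply: rsum_eq => y2; rewrite [RHS]rsum_mull.
Qed.

Let avg_prod (h1 : {ffun S1 -> X1} -> Y1 -> R) (h2 : {ffun S2 -> X2} -> Y2 -> R) :
  avg (fun F1 F2 y1 y2 => h1 F1 y1 * h2 F2 y2) =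
  (\S_(F1) codebook_law P1 F1 * (\S_(y) Q1 (F1 a) y * h1 F1 y)) *
  (\S_(F2) codebook_law P2 F2 * (\S_(y) Q2 (F2 b) y * h2 F2 y)).
Proof.
rewrite -rsum_mulr; apply: rsum_eq => F1.
rewrite -[LHS]rsum_mull -[RHS]rsum_mull; apply: rsum_eq => F2.
have -> : \S_(y1) \S_(y2) Q1 (F1 a) y1 * Q2 (F2 b) y2 * (h1 F1 y1 * h2 F2 y2) =
    (\S_(y) Q1 (F1 a) y * h1 F1 y) * (\S_(y) Q2 (F2 b) y * h2 F2 y).
  rewrite -rsum_mulr; apply: rsum_eq => y1.
  by rewrite -rsum_mull; apply: rsum_eq => y2; ring.
ring.
Qed.

(** A union bound weighted by the conditional law [k]: its total mass replaces the number of wrong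
    candidates. *)
Lemma sum_indicator_le1 (S : finType) (k e : S -> R) (s0 : S) :
  (forall s, 0 <= k s) -> (forall s, s != s0 -> e s <= 1) -> \S_(s) k s <= 1 ->
  \S_(s) ind (s != s0) * k s * e s <= 1.
Proof.
move=> k0 he hk; apply: Rle_trans hk; apply: rsum_le => s; rewrite /ind.
have := k0 s; case: eqP => [_|/eqP /he h] /=; nra.
Qed.

(* The factors 1 give each summand the product shape required by [avg_prod]. *)
Let U1 (F1 : {ffun S1 -> X1}) (_ : {ffun S2 -> X2}) y1 (_ : Y2) :=
  \S_(a') ind (a' != a) * K1 a' b c * (L1 (F1 a') y1 * 1).
Let U2 (_ : {ffun S1 -> X1}) (F2 : {ffun S2 -> X2}) (_ : Y1) y2 :=
  \S_(b') ind (b' != b) * K2 a b' c * (1 * L2 (F2 b') y2).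
Let U12 (F1 : {ffun S1 -> X1}) (F2 : {ffun S2 -> X2}) y1 y2 :=
  \S_(s : S1 * S2) ind ((s.1 != a) && (s.2 != b)) * K12 s.1 s.2 c
     * (L1 (F1 s.1) y1 * L2 (F2 s.2) y2).

Let avgU1 : avg U1 <= 1.
Proof.
rewrite /U1 avg_sum.
under rsum_eq => a' do rewrite (avgZ _ (fun F1 _ y1 _ => L1 (F1 a') y1 * 1))
  (avg_prod (fun F1 => L1 (F1 a')) (fun _ _ => 1)) (transmitted_mass hP2 hQ2) Rmult_1_r.
apply: sum_indicator_le1 => [a'|a' ne|]; first exact: K10.
  exact: impostor_mean.
exact: (cond_prob_sum (proj1 hp) s1 (pairrv s2 w) (b, c)).
Qed.

Let avgU2 : avg U2 <= 1.
Proof.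
rewrite /U2 avg_sum.
under rsum_eq => b' do rewrite (avgZ _ (fun _ F2 _ y2 => 1 * L2 (F2 b') y2))
  (avg_prod (fun _ _ => 1) (fun F2 => L2 (F2 b'))) (transmitted_mass hP1 hQ1) Rmult_1_l.
apply: sum_indicator_le1 => [b'|b' ne|]; first exact: K20.
  exact: impostor_mean.
exact: (cond_prob_sum (proj1 hp) s2 (pairrv s1 w) (a, c)).
Qed.

Let avgU12 : avg U12 <= 1.
Proof.
rewrite /U12 avg_sum.
under rsum_eq => s do rewrite (avgZ _ (fun F1 F2 y1 y2 => L1 (F1 s.1) y1 * L2 (F2 s.2) y2))
  (avg_prod (fun F1 => L1 (F1 s.1)) (fun F2 => L2 (F2 s.2))).
apply: Rle_trans (cond_prob_sum (proj1 hp) (pairrv s1 s2) w c).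
apply: rsum_le => -[a' b'] /=; rewrite -/(K12 a' b' c).
have k0 := K120 a' b' c; rewrite /ind.
have [->|n1] := eqVneq a' a; first by have := K120 a b' c; rewrite /=; lra.
have [->|n2] := eqVneq b' b; first by have := K120 a' b c; rewrite /=; lra.
rewrite /= Rmult_1_l.
(* Both codewords are wrong and the two codebooks are independent, so the two impostor means
   multiply. *)
have i1 := impostor_mean hP1 hQ1 n1; have i2 := impostor_mean hP2 hQ2 n2.
have [c0 _] := codebook_pmf S1 hP1.
have z1 : 0 <= \S_(F1) codebook_law P1 F1 * (\S_(y) Q1 (F1 a) y * L1 (F1 a') y).
  apply: rsum_ge0 => F1; apply: Rmult_le_pos => //; apply: rsum_ge0 => y.
  by apply: Rmult_le_pos => //; case: (hQ1 (F1 a)).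
rewrite -[X in _ <= X]Rmult_1_r; apply: Rmult_le_compat_l => //.
rewrite -[X in _ <= X]Rmult_1_r; apply: Rmult_le_compat => //.
have [d0 _] := codebook_pmf S2 hP2.
apply: rsum_ge0 => F2; apply: Rmult_le_pos => //; apply: rsum_ge0 => y.
by apply: Rmult_le_pos => //; case: (hQ2 (F2 b)).
Qed.

(** If the true pair passes all tests, a wrong accepted pair has one or both components wrong. The
    matching test puts a term above [th] into [U1], [U2] or [U12], whose sum divided by [th] is then
    at least 1. *)
Lemma decoder_error_le dflt F1 F2 y1 y2 :
  ind (threshold_decoder dflt F1 F2 y1 y2 c != (a, b)) <=
    ind (~~ ltb th (K1 a b c * L1 (F1 a) y1))
  + ind (~~ ltb th (K2 a b c * L2 (F2 b) y2))
  + ind (~~ ltb th (K12 a b c * (L1 (F1 a) y1 * L2 (F2 b) y2)))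
  + / th * (U1 F1 F2 y1 y2 + U2 F1 F2 y1 y2 + U12 F1 F2 y1 y2).
Proof.
have ti : 0 < / th by apply: Rinv_0_lt_compat.
have u1 a' : 0 <= ind (a' != a) * K1 a' b c * (L1 (F1 a') y1 * 1).
  rewrite Rmult_1_r; apply: Rmult_le_pos => //; apply: Rmult_le_pos => //; exact: ind_ge0.
have u2 b' : 0 <= ind (b' != b) * K2 a b' c * (1 * L2 (F2 b') y2).
  rewrite Rmult_1_l; apply: Rmult_le_pos => //; apply: Rmult_le_pos => //; exact: ind_ge0.
have u12 (s : S1 * S2) : 0 <= ind ((s.1 != a) && (s.2 != b)) * K12 s.1 s.2 c
     * (L1 (F1 s.1) y1 * L2 (F2 s.2) y2).
  by apply: Rmult_le_pos; apply: Rmult_le_pos => //; exact: ind_ge0.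
have U10 : 0 <= U1 F1 F2 y1 y2 := rsum_ge0 u1.
have U20 : 0 <= U2 F1 F2 y1 y2 := rsum_ge0 u2.
have U120 : 0 <= U12 F1 F2 y1 y2 := rsum_ge0 u12.
have t1 := ind_ge0 (~~ ltb th (K1 a b c * L1 (F1 a) y1)).
have t2 := ind_ge0 (~~ ltb th (K2 a b c * L2 (F2 b) y2)).
have t3 := ind_ge0 (~~ ltb th (K12 a b c * (L1 (F1 a) y1 * L2 (F2 b) y2))).
have big : th < U1 F1 F2 y1 y2 + U2 F1 F2 y1 y2 + U12 F1 F2 y1 y2 ->
    1 <= / th * (U1 F1 F2 y1 y2 + U2 F1 F2 y1 y2 + U12 F1 F2 y1 y2).
  move=> h; have e : / th * th = 1 by field; lra.
  by rewrite -[X in X <= _]e; apply: Rmult_le_compat_l; lra.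
have nn : 0 <= / th * (U1 F1 F2 y1 y2 + U2 F1 F2 y1 y2 + U12 F1 F2 y1 y2).
  by apply: Rmult_le_pos; lra.
case pab : (passes a b c (F1 a) (F2 b) y1 y2); last first.
  have l1 := ind_le1 (threshold_decoder dflt F1 F2 y1 y2 c != (a, b)).
  move: pab t1 t2 t3; rewrite /passes.
  by do 3 case: (ltb th _); rewrite //= => _; lra.
rewrite /threshold_decoder; case: pickP => [[a' b'] /= |/(_ (a, b))]; last by rewrite /= pab.
rewrite xpair_eqE => /and3P [/ltbP h1 /ltbP h2 /ltbP h3].
have [ea|na] := eqVneq a' a; have [eb|nb] := eqVneq b' b; rewrite /=.
- by lra.
- suff : th < U2 F1 F2 y1 y2 by move=> h; have := big; lra.
  have := rsum_ge_term b' u2; rewrite nb /ind Rmult_1_l Rmult_1_l -/(U2 F1 F2 y1 y2).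
  by rewrite ea in h2; lra.
- suff : th < U1 F1 F2 y1 y2 by move=> h; have := big; lra.
  have := rsum_ge_term a' u1; rewrite na /ind Rmult_1_l Rmult_1_r -/(U1 F1 F2 y1 y2).
  by rewrite eb in h1; lra.
- suff : th < U12 F1 F2 y1 y2 by move=> h; have := big; lra.
  have := rsum_ge_term (a', b') u12; rewrite /= na nb /ind Rmult_1_l.
  by rewrite -/(U12 F1 F2 y1 y2); lra.
Qed.

(** Each test has its own Chernoff exponent, because the exponents that give decay may differ
    between the three conditions. *)
Lemma mean_error_le dflt r1 r2 r3 :
  0 <= r1 -> 0 <= r2 -> 0 <= r3 ->
  0 < K1 a b c -> 0 < K2 a b c -> 0 < K12 a b c ->
  avg (fun F1 F2 y1 y2 => ind (threshold_decoder dflt F1 F2 y1 y2 c != (a, b))) <=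
    exp (r1 * ln th) * npow r1 (K1 a b c) * imom P1 Q1 r1
  + exp (r2 * ln th) * npow r2 (K2 a b c) * imom P2 Q2 r2
  + exp (r3 * ln th) * npow r3 (K12 a b c) * (imom P1 Q1 r3 * imom P2 Q2 r3)
  + 3 / th.
Proof.
move=> r10 r20 r30 k1 k2 k12; have ti : 0 < / th by apply: Rinv_0_lt_compat.
apply: (Rle_trans _ (avg (fun F1 F2 y1 y2 =>
    exp (r1 * ln th) * npow r1 (K1 a b c) * (npow r1 (L1 (F1 a) y1) * 1)
  + exp (r2 * ln th) * npow r2 (K2 a b c) * (1 * npow r2 (L2 (F2 b) y2))
  + exp (r3 * ln th) * npow r3 (K12 a b c) * (npow r3 (L1 (F1 a) y1) * npow r3 (L2 (F2 b) y2))
  + / th * (U1 F1 F2 y1 y2 + U2 F1 F2 y1 y2 + U12 F1 F2 y1 y2)))).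
  apply: avg_le => F1 F2 y1 y2 f1 f2 g1 g2.
  have l1 : 0 < L1 (F1 a) y1.
    by apply: Rdiv_lt_0_compat => //; apply: out_gt0 hP1 hQ1 f1 g1.
  have l2 : 0 < L2 (F2 b) y2.
    by apply: Rdiv_lt_0_compat => //; apply: out_gt0 hP2 hQ2 f2 g2.
  apply: Rle_trans (decoder_error_le dflt F1 F2 y1 y2) _.
  apply: Rplus_le_compat_r; rewrite !Rmult_1_r !Rmult_1_l.
  have tail r x y : 0 <= r -> 0 < x -> 0 < y ->
      ind (~~ ltb th (x * y)) <= exp (r * ln th) * npow r x * npow r y.
    move=> hr hx hy; rewrite Rmult_assoc -npowM //; apply: tail_npow => //.
    exact: Rmult_lt_0_compat.
  have tA := tail r1 _ _ r10 k1 l1; have tB := tail r2 _ _ r20 k2 l2.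
  have tC := tail r3 _ _ r30 k12 (Rmult_lt_0_compat _ _ l1 l2).
  rewrite (npowM _ l1 l2) in tC.
  by apply: Rplus_le_compat tC; apply: Rplus_le_compat.
rewrite !avgD (avgZ (exp (r1 * ln th) * npow r1 (K1 a b c))).
rewrite (avgZ (exp (r2 * ln th) * npow r2 (K2 a b c))).
rewrite (avgZ (exp (r3 * ln th) * npow r3 (K12 a b c))) (avgZ (/ th)) !avgD.
rewrite (avg_prod (fun F1 y1 => npow r1 (L1 (F1 a) y1)) (fun _ _ => 1)).
rewrite (avg_prod (fun _ _ => 1) (fun F2 y2 => npow r2 (L2 (F2 b) y2))).
rewrite (avg_prod (fun F1 y1 => npow r3 (L1 (F1 a) y1)) (fun F2 y2 => npow r3 (L2 (F2 b) y2))).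
rewrite (transmitted_mass hP2 hQ2) (transmitted_mass hP1 hQ1).
rewrite !(transmitted_mean Q1 hP1 a (fun x y => npow _ (L1 x y))).
rewrite !(transmitted_mean Q2 hP2 b (fun x y => npow _ (L2 x y))).
rewrite Rmult_1_l Rmult_1_r /Rdiv [3 * _]Rmult_comm.
apply: Rplus_le_compat; first by right.
by apply: Rmult_le_compat_l; lra.
Qed.

End FixedSource.

Lemma one_shot_achievability r1 r2 r3 : 0 <= r1 -> 0 <= r2 -> 0 <= r3 ->
  exists g : {ffun S1 -> X1} -> {ffun S2 -> X2} -> Y1 -> Y2 -> W -> S1 * S2,
  \S_(F1) codebook_law P1 F1 * (\S_(F2) codebook_law P2 F2 *
    perr p s1 s2 w Q1 Q2 F1 F2 (g F1 F2)) <=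
    exp (r1 * ln th) * cmom p s1 (pairrv s2 w) r1 * imom P1 Q1 r1
  + exp (r2 * ln th) * cmom p s2 (pairrv s1 w) r2 * imom P2 Q2 r2
  + exp (r3 * ln th) * cmom p (pairrv s1 s2) w r3 * (imom P1 Q1 r3 * imom P2 Q2 r3)
  + 3 / th.
Proof.
move=> r10 r20 r30; have [t0] := pmf_inhabited hp; have [p0 p1] := hp.
exists (threshold_decoder (s1 t0, s2 t0)).
set B3 := 3 / th.
apply: (Rle_trans _ (\S_(t) p t *
   (exp (r1 * ln th) * npow r1 (K1 (s1 t) (s2 t) (w t)) * imom P1 Q1 r1
  + exp (r2 * ln th) * npow r2 (K2 (s1 t) (s2 t) (w t)) * imom P2 Q2 r2
  + exp (r3 * ln th) * npow r3 (K12 (s1 t) (s2 t) (w t)) * (imom P1 Q1 r3 * imom P2 Q2 r3)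
  + B3))); last first.
  have eB : B3 = \S_(t) p t * B3 by rewrite rsum_mulr p1 Rmult_1_l.
  right; rewrite [X in _ = _ + X]eB /cmom.
  move: (imom P1 Q1 r1) (imom P2 Q2 r2) (imom P1 Q1 r3 * imom P2 Q2 r3) => i1 i2 i3.
  rewrite -!rsum_mull -!rsum_mulr -!rsumD; apply: rsum_eq => t.
  by rewrite /K1 /K2 /K12 /pairrv /=; ring.
apply: (Rle_trans _ (\S_(t) p t * (\S_(F1) codebook_law P1 F1 * (\S_(F2) codebook_law P2 F2 *
    (\S_(y1) \S_(y2) Q1 (F1 (s1 t)) y1 * Q2 (F2 (s2 t)) y2 *
     ind (threshold_decoder (s1 t0, s2 t0) F1 F2 y1 y2 (w t) != (s1 t, s2 t))))))).
  right; under [RHS]rsum_eq => t do rewrite -rsum_mull.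
  rewrite [RHS]rsum_exch; apply: rsum_eq => F1.
  rewrite -rsum_mull; under [RHS]rsum_eq => t do rewrite -!rsum_mull.
  rewrite [RHS]rsum_exch; apply: rsum_eq => F2.
  rewrite -!rsum_mull; apply: rsum_eq => t; ring.
apply: rsum_le => t; case: (Rle_lt_or_eq_dec _ _ (p0 t)) => h; last by rewrite -h; lra.
apply: Rmult_le_compat_l => //; apply: mean_error_le => //.
- exact: (cond_prob_gt0 p0 s1 (pairrv s2 w) h).
- exact: (cond_prob_gt0 p0 s2 (pairrv s1 w) h).
- exact: (cond_prob_gt0 p0 (pairrv s1 s2) w h).
Qed.

End OneShotAchievability.

(** * Achievability for block codes *)

Lemma npow_rprod (T : finType) s (F : T -> R) : (forall t, 0 < F t) ->
  npow s (rprod F) = \P_(t) npow s (F t).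
Proof.
move=> h; suff: 0 < rprod F /\ npow s (rprod F) = \P_(t) npow s (F t) by case.
rewrite /rprod; elim/big_ind2: _ => [|x1 x2 y1 y2|t _].
- by rewrite /npow ln_1 Rmult_0_r exp_0; lra.
- by move=> [? <-] [? <-]; rewrite npowM //; split=> //; apply: Rmult_lt_0_compat.
- by split.
Qed.

Lemma rprod_div (T : finType) (F G : T -> R) :
  \P_(t) F t / G t = rprod F / rprod G.
Proof.
rewrite rprodM; congr (_ * _); rewrite /rprod.
elim/big_ind2: _ => [|x1 x2 y1 y2 -> ->|//]; first by rewrite Rinv_1.
by rewrite Rinv_mult.
Qed.

(** Conditional probabilities of blocks factor over letters, so the moment is a power. As for
    entropies, only the fibres of [F] and [G] matter. *)
Lemma cmom_blk (T U V A B : finType) (p : T -> R) m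
    (F : {ffun 'I_m -> T} -> A) (G : {ffun 'I_m -> T} -> B) (f : T -> U) (g : T -> V) s :
  pmf p ->
  (forall t t', (pairrv F G t' == pairrv F G t) =
     [forall i, pairrv f g (t' i) == pairrv f g (t i)]) ->
  (forall t t', (G t' == G t) = [forall i, g (t' i) == g (t i)]) ->
  cmom (pblk p) F G s = cmom p f g s ^ m.
Proof.
move=> hp hFG hG; have [p0 _] := hp.
rewrite -[in RHS](card_ord m) -rprod_const /cmom rprod_rsum; apply: rsum_eq => t.
rewrite rprodM; have [pb0 _] := pmf_pblk m hp.
case: (Rle_lt_or_eq_dec _ _ (pb0 t)) => h; last first.
  by rewrite -/(pblk p t) -h; ring.
have pt i : 0 < p (t i) := rprod_gt0_inv i (fun i => p0 (t i)) h.
congr (_ * _); rewrite cond_probE (fiber_mass_blk _ hFG) (fiber_mass_blk _ hG).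
rewrite -rprod_div npow_rprod // => i.
exact: (cond_prob_gt0 p0 f g (pt i)).
Qed.

Lemma out_blk (X Y : finType) n (P : X -> R) (a : X -> Y -> R) (y : {ffun 'I_n -> Y}) :
  out (pblk P) (kblk a) y = \P_(j) out P a (y j).
Proof. by rewrite rprod_rsum; apply: rsum_eq => x; rewrite rprodM. Qed.

Lemma imom_blk (X Y : finType) n (P : X -> R) (a : X -> Y -> R) s :
  pmf P -> kernel a ->
  imom (pblk (m := n) P) (kblk a) s = imom P a s ^ n.
Proof.
move=> hP ha; have [P0 _] := hP; have [pb0 _] := pmf_pblk n hP.
rewrite -[in RHS](card_ord n) -rprod_const /imom rprod_rsum; apply: rsum_eq => x.
rewrite rprodM -/(pblk P x).
case: (Rle_lt_or_eq_dec _ _ (pb0 x)) => hx; last by rewrite -hx; ring.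
have px j : 0 < P (x j) := rprod_gt0_inv j (fun i => P0 (x i)) hx.
congr (_ * _); rewrite rprod_rsum; apply: rsum_eq => y.
rewrite rprodM -/(kblk a x y); have [k0 _] := kernel_kblk ha x.
case: (Rle_lt_or_eq_dec _ _ (k0 y)) => hy; last by rewrite -hy; ring.
have ay j : 0 < a (x j) (y j).
  by apply: (rprod_gt0_inv j _ hy) => i; case: (ha (x i)).
congr (_ * _); rewrite out_blk -rprod_div npow_rprod // => j.
by apply: Rdiv_lt_0_compat => //; apply: out_gt0 hP ha (px j) (ay j).
Qed.

(* [h] bounds the slope of ln M at 0, which is all that decides exponential decay. *)
Definition subexp (M : R -> R) (h : R) : Prop :=
  exists C, 0 < C /\ forall s, 0 <= s <= / C -> 0 <= M s <= exp (s * h + s * s * C).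

Lemma subexp_mul M N h k : subexp M h -> subexp N k ->
  subexp (fun s => M s * N s) (h + k).
Proof.
move=> [C [C0 hC]] [D [D0 hD]]; exists (C + D); split=> [|s hs]; first lra.
have hs1 : 0 <= s <= / C.
  by split; [lra|apply: Rle_trans (proj2 hs) _; apply: Rinv_le_contravar; lra].
have hs2 : 0 <= s <= / D.
  by split; [lra|apply: Rle_trans (proj2 hs) _; apply: Rinv_le_contravar; lra].
have [m0 m1] := hC s hs1; have [n0 n1] := hD s hs2; split; first exact: Rmult_le_pos.
rewrite (_ : _ + _ = (s * h + s * s * C) + (s * k + s * s * D)); last ring.
by rewrite exp_plus; apply: Rmult_le_compat.
Qed.

Lemma subexp_pow M h n : subexp M h -> subexp (fun s => M s ^ n) (INR n * h).
Proof.
move=> hM; elim: n => [|n IH].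
  exists 1; split=> [|s hs]; first lra.
  split; first by rewrite /=; lra.
  by have := exp_ineq1_le (s * (INR 0 * h) + s * s * 1); rewrite /=; nra.
rewrite S_INR (_ : _ * h = h + INR n * h); last ring.
exact: subexp_mul.
Qed.

(** From exp (-u) >= 1 - u one gets exp u (1-u) <= 1, while (1 + u + 2u^2)(1 - u) = 1 + u^2 (1 - 2u)
    >= 1. *)
Lemma exp_le_quadratic u : u <= 1 / 2 -> exp u <= 1 + u + 2 * (u * u).
Proof.
move=> hu; have h := exp_ineq1_le (- u); have e0 := exp_pos u.
have e1 : exp u * exp (- u) = 1 by rewrite -exp_plus Rplus_opp_r exp_0.
have e2 : exp u * (1 - u) <= 1 by nra.
have e3 : 0 <= u * u * (1 - 2 * u) by apply: Rmult_le_pos; nra.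
by apply: (Rmult_le_reg_r (1 - u)); lra.
Qed.

Lemma subexp_mgf (T : finType) (mu g : T -> R) : pmf mu ->
  subexp (fun s => \S_(t) mu t * exp (s * g t)) (\S_(t) mu t * g t).
Proof.
move=> [m0 m1]; set Q := \S_(t) g t * g t.
have sq t : 0 <= g t * g t by nra.
have gQ t : g t * g t <= Q := rsum_ge_term t sq.
have Q0 : 0 <= Q := rsum_ge0 sq.
(* As g^2 <= Q implies g <= 1 + Q, the range s <= 1/(2(1+Q)) forces s g <= 1/2; the same constant
   dominates the quadratic coefficient 2Q. *)
exists (2 * (1 + Q)); split=> [|s hs]; first lra.
split; first by apply: rsum_ge0 => t; apply: Rmult_le_pos => //; left; exact: exp_pos.
have sQ : s * (1 + Q) <= 1 / 2.
  have e : / (2 * (1 + Q)) * (2 * (1 + Q)) = 1 by field; lra.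
  nra.
apply: (Rle_trans _ (\S_(t) (mu t + s * (mu t * g t) + 2 * (s * s) * Q * mu t))).
  apply: rsum_le => t.
  have gb : g t <= 1 + Q by have := gQ t; nra.
  have u2 : s * g t <= 1 / 2 by nra.
  have ss : 0 <= s * s by nra.
  have := exp_le_quadratic u2; have := gQ t; have := m0 t => a b c.
  have d : s * s * (g t * g t) <= s * s * Q by nra.
  have e : exp (s * g t) <= 1 + s * g t + 2 * (s * s) * Q by lra.
  have := Rmult_le_compat_l _ _ _ a e; lra.
rewrite !rsumD !rsum_mull m1.
have := exp_ineq1_le (s * (\S_(t) mu t * g t) + s * s * (2 * (1 + Q))).
nra.
Qed.

Lemma subexp_ext M N h k : (forall s, M s = N s) -> h = k -> subexp M h -> subexp N k.
Proof. by move=> e <- [C [C0 hC]]; exists C; split=> // s; rewrite -e; exact: hC. Qed.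

Lemma subexp_cmom (T U V : finType) (p : T -> R) (u : T -> U) (v : T -> V) :
  pmf p -> subexp (cmom p u v) (cent p u v).
Proof.
move=> hp; have [p0 _] := hp.
apply: subexp_ext (subexp_mgf (fun t => - ln (cond_prob p u v (u t) (v t))) hp) => [s|].
  by apply: rsum_eq => t; congr (_ * exp _); ring.
by rewrite cent_cond_prob // -rsumN; apply: rsum_eq => t; ring.
Qed.

Lemma subexp_imom (X Y : finType) (P : X -> R) (a : X -> Y -> R) :
  pmf P -> kernel a -> subexp (imom P a) (- mi P a).
Proof.
move=> hP ha; have [P0 P1] := hP.
have hmu : pmf (fun t : X * Y => P t.1 * a t.1 t.2).
  split=> [t|]; first by apply: Rmult_le_pos => //; case: (ha t.1).
  by rewrite rsum_pair -P1; apply: rsum_eq => x /=; rewrite rsum_mull; have [_ ->] := ha x; ring.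
apply: subexp_ext (subexp_mgf (fun t => - ln (a t.1 t.2 / out P a t.2)) hmu) => [s|].
  rewrite rsum_pair; apply: rsum_eq => x; rewrite -rsum_mull; apply: rsum_eq => y /=.
  by rewrite Rmult_assoc; congr (_ * (_ * exp _)); ring.
rewrite rsum_pair -rsumN; apply: rsum_eq => x; rewrite -rsumN; apply: rsum_eq => y /=; ring.
Qed.

Lemma subexp_decay M h c : subexp M h -> h + c < 0 ->
  exists s, 0 <= s /\ 0 <= exp (s * c) * M s < 1.
Proof.
move=> [C [C0 hC]] hc; set D := - (h + c).
have D0 : 0 < D by rewrite /D; lra.
have Ci : 0 < / C by apply: Rinv_0_lt_compat.
have e : / C * C = 1 by field; lra.
(* The exponent is at most s (sC - D), and sC <= D/2 makes it negative. *)
pose s := Rmin (/ C) (D / 2 * / C).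
have s0 : 0 < s by apply: Rmin_glb_lt => //; apply: Rmult_lt_0_compat; lra.
have s1 : s <= / C := Rmin_l _ _; have s2 : s <= D / 2 * / C := Rmin_r _ _.
exists s; split; first lra.
have [M0 M1] := hC s (conj (Rlt_le _ _ s0) s1); have ec := exp_pos (s * c).
split; first by nra.
apply: (Rle_lt_trans _ (exp (s * c) * exp (s * h + s * s * C))); first by nra.
rewrite -exp_plus -exp_0; apply: exp_increasing.
have sC : s * C <= D / 2 by nra.
have -> : s * c + (s * h + s * s * C) = s * (s * C - D) by rewrite /D; ring.
nra.
Qed.

Lemma exp_mul_nat t x : exp (INR t * x) = exp x ^ t.
Proof.
elim: t => [|t IH]; first by rewrite /= Rmult_0_l exp_0.
by rewrite S_INR /= -IH -exp_plus; congr exp; ring.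
Qed.

Lemma pow_mulnr x k t : x ^ (k * t)%N = (x ^ k) ^ t.
Proof. by rewrite -multE pow_mult. Qed.

Lemma geometric_small r e : 0 <= r < 1 -> 0 < e ->
  exists N, forall t, (N <= t)%N -> r ^ t < e.
Proof.
move=> hr he; have ar : Rabs r < 1 by rewrite Rabs_right; lra.
have [N hN] := pow_lt_1_zero r ar e he; exists N => t /leP ht.
exact: Rle_lt_trans (Rle_abs _) (hN t ht).
Qed.

Section ReceiverAchievability.
Variables (T S1 S2 W X1 X2 Y1 Y2 : finType) (p : T -> R).
Variables (s1 : T -> S1) (s2 : T -> S2) (w : T -> W).
Variables (P1 : X1 -> R) (P2 : X2 -> R) (a1 : X1 -> Y1 -> R) (a2 : X2 -> Y2 -> R).
Variables (m0 n0 : nat).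
Hypotheses (hp : pmf p) (hP1 : pmf P1) (hP2 : pmf P2).
Hypotheses (ha1 : kernel a1) (ha2 : kernel a2).
Hypothesis c1 : INR m0 * cent p s1 (pairrv s2 w) < INR n0 * mi P1 a1.
Hypothesis c2 : INR m0 * cent p s2 (pairrv s1 w) < INR n0 * mi P2 a2.
Hypothesis c12 : INR m0 * cent p (pairrv s1 s2) w < INR n0 * (mi P1 a1 + mi P2 a2).

Lemma receiver_achievability e : 0 < e -> exists N, forall t, (N <= t)%N ->
  exists g : {ffun {ffun 'I_(m0 * t) -> S1} -> {ffun 'I_(n0 * t) -> X1}} ->
    {ffun {ffun 'I_(m0 * t) -> S2} -> {ffun 'I_(n0 * t) -> X2}} ->
    {ffun 'I_(n0 * t) -> Y1} -> {ffun 'I_(n0 * t) -> Y2} -> {ffun 'I_(m0 * t) -> W} ->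
    {ffun 'I_(m0 * t) -> S1} * {ffun 'I_(m0 * t) -> S2},
  \S_(F1) codebook_law (pblk P1) F1 * (\S_(F2) codebook_law (pblk P2) F2 *
    perr (pblk p) (blk s1) (blk s2) (blk w) (kblk a1) (kblk a2) F1 F2 (g F1 F2)) < e.
Proof.
move=> e0.
set D1 := INR n0 * mi P1 a1 - INR m0 * cent p s1 (pairrv s2 w).
set D2 := INR n0 * mi P2 a2 - INR m0 * cent p s2 (pairrv s1 w).
set D12 := INR n0 * (mi P1 a1 + mi P2 a2) - INR m0 * cent p (pairrv s1 s2) w.
(* [c] is the growth rate of the threshold exp (t c). Below all three gaps it still lets every
   Chernoff term decay, and being positive it makes 3/th vanish. *)
have [c [h0 [h1 [h2 h12]]]] : exists c, 0 < c /\ c < D1 /\ c < D2 /\ c < D12.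
  exists (Rmin D1 (Rmin D2 D12) / 2).
  have := Rmin_l D1 (Rmin D2 D12); have := Rmin_r D1 (Rmin D2 D12).
  have := Rmin_l D2 D12; have := Rmin_r D2 D12.
  have : 0 < Rmin D1 (Rmin D2 D12).
    by apply: Rmin_glb_lt; [|apply: Rmin_glb_lt]; rewrite /D1 /D2 /D12; lra.
  by lra.
have x1 := subexp_mul (subexp_pow m0 (subexp_cmom s1 (pairrv s2 w) hp))
                      (subexp_pow n0 (subexp_imom hP1 ha1)).
have x2 := subexp_mul (subexp_pow m0 (subexp_cmom s2 (pairrv s1 w) hp))
                      (subexp_pow n0 (subexp_imom hP2 ha2)).
have x12 := subexp_mul (subexp_pow m0 (subexp_cmom (pairrv s1 s2) w hp))
  (subexp_pow n0 (subexp_mul (subexp_imom hP1 ha1) (subexp_imom hP2 ha2))).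
have [|r1 [r10 g1]] := subexp_decay (c := c) x1; first by rewrite /D1 in h1; lra.
have [|r2 [r20 g2]] := subexp_decay (c := c) x2; first by rewrite /D2 in h2; lra.
have [|r12 [r120 g12]] := subexp_decay (c := c) x12; first by rewrite /D12 in h12; lra.
have g0 : 0 <= exp (- c) < 1.
  split; first by left; exact: exp_pos.
  by rewrite -exp_0; apply: exp_increasing; lra.
(* Three Chernoff terms below e/6 and the Markov term below 3 e/6 add up to less than e. *)
have e6 : 0 < e / 6 by lra.
have [N1 hN1] := geometric_small g1 e6; have [N2 hN2] := geometric_small g2 e6.
have [N3 hN3] := geometric_small g12 e6; have [N4 hN4] := geometric_small g0 e6.
exists (N1 + N2 + N3 + N4)%N => t ht.
have [t1 t2 t3 t4] : [/\ (N1 <= t)%N, (N2 <= t)%N, (N3 <= t)%N & (N4 <= t)%N].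
  by move/leP: ht; rewrite -!plusE => ht; split; apply/leP; lia.
move: (hN1 t t1) (hN2 t t2) (hN3 t t3) (hN4 t t4) => {}hN1 {}hN2 {}hN3 {}hN4.
have [g hg] := one_shot_achievability (blk s1) (blk s2) (blk w)
  (pmf_pblk (m0 * t) hp) (pmf_pblk (n0 * t) hP1) (pmf_pblk (n0 * t) hP2)
  (kernel_kblk ha1) (kernel_kblk ha2) (exp_pos (INR t * c)) r10 r20 r120.
exists g; apply: Rle_lt_trans hg _.
rewrite ln_exp !imom_blk //.
rewrite (cmom_blk (f := s1) (g := pairrv s2 w)) //; last first.
- by move=> *; apply: pair_blk_fiber; exact: blk_fiber.
- move=> *; apply: pair_blk_fiber; first exact: blk_fiber.
  by apply: pair_blk_fiber; exact: blk_fiber.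
rewrite (cmom_blk (f := s2) (g := pairrv s1 w)) //; last first.
- by move=> *; apply: pair_blk_fiber; exact: blk_fiber.
- move=> *; apply: pair_blk_fiber; first exact: blk_fiber.
  by apply: pair_blk_fiber; exact: blk_fiber.
rewrite (cmom_blk (f := pairrv s1 s2) (g := w)) //; last first.
- by move=> *; exact: blk_fiber.
- move=> *; apply: pair_blk_fiber; last exact: blk_fiber.
  by apply: pair_blk_fiber; exact: blk_fiber.
have expo r : exp (r * (INR t * c)) = exp (r * c) ^ t.
  by rewrite -exp_mul_nat; congr exp; ring.
rewrite !expo !pow_mulnr -!Rpow_mult_distr !Rmult_assoc.
rewrite /Rdiv -exp_Ropp (_ : - (INR t * c) = INR t * - c); last ring.
rewrite exp_mul_nat; lra.
Qed.

End ReceiverAchievability.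

(** * Codebooks common to both receivers *)

Section TwoReceiverAchievability.
Variables (S1 S2 W1 W2 X1 X2 Y11 Y12 Y21 Y22 : finType).
Variables (p : srcT S1 S2 W1 W2 -> R) (hp : pmf p).
Variables (q1 : X1 -> Y11 * Y12 -> R) (hq1 : kernel q1).
Variables (q2 : X2 -> Y21 * Y22 -> R) (hq2 : kernel q2).

Lemma mean_lt_exists (T : finType) (mu F : T -> R) e :
  pmf mu -> \S_(t) mu t * F t < e -> exists t, F t < e.
Proof.
move=> [m0 m1] h; apply: NNPP => nex; apply: (Rlt_irrefl e).
apply: Rle_lt_trans h; rewrite -{1}[e]Rmult_1_l -m1 -rsum_mulr.
apply: rsum_le => t; apply: Rmult_le_compat_l => //.
by apply: Rnot_lt_le => ht; apply: nex; exists t.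
Qed.

(** Block lengths [m0 * t] and [n0 * t] keep the ratio exactly equal to [b], as [achievable]
    demands, while [t] grows. *)
Lemma achievable_direct b P1 P2 n0 m0 : (0 < n0)%N -> (0 < m0)%N -> b = INR n0 / INR m0 ->
  pmf P1 -> pmf P2 -> mac_conditions Rlt p q1 q2 P1 P2 b -> achievable p q1 q2 b.
Proof.
move=> hn hm hb hP1 hP2 /(mac_conditionsE _ hq1 hq2 _ _ hP1 hP2) [[u1 [u2 u3]] [v1 [v2 v3]]] e e0.
have m0' := INR_gt0 hm.
have scale x y : x < b * y -> INR m0 * x < INR n0 * y.
  move=> h; have -> : INR n0 * y = INR m0 * (b * y) by rewrite hb; field; lra.
  exact: Rmult_lt_compat_l.
have e2 : 0 < e / 2 by lra.
have [N1 h1] := receiver_achievability hp hP1 hP2 (marg_kernel fst hq1) (marg_kernel fst hq2)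
  (scale _ _ u1) (scale _ _ u2) (scale _ _ u3) e2.
have [N2 h2] := receiver_achievability hp hP1 hP2 (marg_kernel snd hq1) (marg_kernel snd hq2)
  (scale _ _ v1) (scale _ _ v2) (scale _ _ v3) e2.
(* The successor keeps both block lengths positive even if [N1] and [N2] are 0. *)
pose t := (N1 + N2).+1.
have [g1 hg1] := h1 t (leqW (leq_addr _ _)).
have [g2 hg2] := h2 t (leqW (leq_addl _ _)).
exists (m0 * t)%N, (n0 * t)%N; rewrite !muln_gt0 hn hm; split=> //; split=> //; split.
  have t0 : 0 < INR t := INR_gt0 (ltn0Sn (N1 + N2)).
  by rewrite hb !mult_INR; field; lra.
have cb1 := codebook_pmf {ffun 'I_(m0 * t) -> S1} (pmf_pblk (n0 * t) hP1).
have cb2 := codebook_pmf {ffun 'I_(m0 * t) -> S2} (pmf_pblk (n0 * t) hP2).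
(* The two receivers' errors are added under the average; codebooks good for each receiver
   separately need not coincide. *)
have [F1] : exists F1 : {ffun {ffun 'I_(m0 * t) -> S1} -> {ffun 'I_(n0 * t) -> X1}},
    \S_(F2 : {ffun {ffun 'I_(m0 * t) -> S2} -> {ffun 'I_(n0 * t) -> X2}}) codebook_law (pblk P2) F2 *
    (perr (pblk p) (blk (@s1_ _ _ _ _)) (blk (@s2_ _ _ _ _)) (blk (@w1_ _ _ _ _))
       (kblk (marg fst q1)) (kblk (marg fst q2)) F1 F2 (g1 F1 F2) +
     perr (pblk p) (blk (@s1_ _ _ _ _)) (blk (@s2_ _ _ _ _)) (blk (@w2_ _ _ _ _))
       (kblk (marg snd q1)) (kblk (marg snd q2)) F1 F2 (g2 F1 F2)) < e.
  apply: mean_lt_exists cb1 _.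
  under rsum_eq => F1 do (under rsum_eq => F2 do rewrite Rmult_plus_distr_l).
  under rsum_eq => F1 do rewrite rsumD Rmult_plus_distr_l.
  by rewrite rsumD (_ : e = e / 2 + e / 2); [exact: Rplus_lt_compat hg1 hg2|lra].
move/(mean_lt_exists cb2) => [F2 hF].
exists F1, F2, (g1 F1 F2), (g2 F1 F2).
exact: Rle_lt_trans (err_prob_le_perr hp hq1 hq2 F1 F2 (g1 F1 F2) (g2 F1 F2)) hF.
Qed.

End TwoReceiverAchievability.

Theorem theorem7
  (S1 S2 W1 W2 X1 X2 Y11 Y12 Y21 Y22 : finType)
  (p : srcT S1 S2 W1 W2 -> R) (hp : pmf p)
  (q1 : X1 -> Y11 * Y12 -> R) (hq1 : kernel q1)
  (q2 : X2 -> Y21 * Y22 -> R) (hq2 : kernel q2)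
  (b : R) :
  ((exists n0 m0 : nat, (0 < n0)%N /\ (0 < m0)%N /\ b = INR n0 / INR m0) ->
   (exists (P1 : X1 -> R) (P2 : X2 -> R),
      pmf P1 /\ pmf P2 /\ mac_conditions Rlt p q1 q2 P1 P2 b) ->
   achievable p q1 q2 b)
  /\
  (achievable p q1 q2 b ->
   exists (P1 : X1 -> R) (P2 : X2 -> R),
      pmf P1 /\ pmf P2 /\ mac_conditions Rle p q1 q2 P1 P2 b).
Proof.
split; last exact: achievable_converse.
move=> [n0 [m0 [hn [hm hb]]]] [P1 [P2 [hP1 [hP2 hmac]]]].
exact: achievable_direct hn hm hb hP1 hP2 hmac.
Qed.
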